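(* Let $T$ be a locally finite, spherically homogeneous rooted tree, and let $G\le \mathrm{Aut}(T)$ be a finitely generated branch group whose action on $\partial T$ has finite groups of germs. Let $H\le G$ be a subgroup such that the Schreier graph $\Gamma_{G/H}$ has more than one end. Then: (a) either the action of $G$ on $G/H$ is not faithful (and thus factors through a virtually abelian quotient of $G$); (b) or $H$ is a finite-index subgroup of the stabilizer $G_\xi$ of a point $\xi\in\partial T$; in this case, the number of ends of $\Gamma_{G/H}$ does not exceed that of the graph of germs $\widetilde\Gamma_\xi$. In particular, $G$ has Property FW if and only if it is just-infinite and all graphs of germs $\widetilde\Gamma_\xi$, $\xi\in\partial T$, are one-ended.
   Context: Rooted trees and branch groups. $T$ is a locally finite rooted tree, spherically homogeneous (all vertices at the same distance from the root have the same degree); $\partial T$ is its boundary (geodesic rays from the root, with the usual compact topology); $\mathrm{Aut}(T)$ is the group of root-preserving automorphisms. For a vertex $v$, $|v|$ is its distance from the root and $T_v$ is the subtree of descendants of $v$ (including $v$). For $G\le \mathrm{Aut}(T)$, the rigid stabilizer $\mathrm{RiSt}(v)$ is the subgroup of elements of $G$ fixing every vertex of $T\setminus T_v$, and $\mathrm{RiSt}(n)=\langle \mathrm{RiSt}(v): |v|=n\rangle$. $G$ is branch if it acts transitively on every level of $T$ and $\mathrm{RiSt}(n)$ has finite index in $G$ for every $n$. $G$ is just-infinite if every proper quotient (quotient by a nontrivial normal subgroup) is finite. Germs. For $\xi\in\partial T$, $G_\xi$ is its stabilizer and $G^0_\xi\trianglelefteq G_\xi$ is the subgroup of elements fixing pointwise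 some neighbourhood of $\xi$ in $\partial T$. The group of germs at $\xi$ is $G_\xi/G_\xi^0$; ''finite groups of germs'' means it is finite for every $\xi$. Schreier graphs and ends. Fix a finite symmetric generating set $S$ of $G$. For $H\le G$, $\Gamma_{G/H}$ is the graph with vertex set $G/H$ and edges $(x,sx)$, $s\in S$. The graph of germs is $\widetilde\Gamma_\xi=\Gamma_{G/G_\xi^0}$. The number of ends of a connected locally finite graph is the supremum, over finite vertex sets $\Sigma$, of the number of infinite connected components of the complement of $\Sigma$ (for Schreier graphs it does not depend on $S$); one-ended means that this number is 1. Property FW. For an action of $G$ on a set $X$, a subset $A\subset X$ is commensurated if $gA\triangle A$ is finite for all $g\in G$, and transfixed if it has finite symmetric difference with a $G$-invariant subset. $G$ has Property FW if every commensurated subset of every $G$-set is transfixed.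
   Formalization: The final equivalence on Property FW is stated for infinite G only: for T a single ray and G trivial, G has FW but its graph of germs is a point with 0 ends, so the clause fails; for finite T, also left out, it holds trivially. *)

(* Defs.v *)
From HB Require Import structures.
From Stdlib Require Import Relation_Operators.
From mathcomp Require Import all_boot all_order.
From mathcomp Require Import boolp classical_sets functions cardinality.

Set Implicit Arguments.
Unset Strict Implicit.
Unset Printing Implicit Defensive.

Local Open Scope classical_set_scope.
Local Open Scope card_scope.
Local Open Scope group_scope.

Section Groups.
Variable gT : groupType.
Implicit Types (A B G H N S : set gT).

Record is_subgroup A : Prop := IsSubgroup {
  subgroup1 : A 1;
  subgroupM : forall x y, A x -> A y -> A (x * y);
  subgroupV : forall x, A x -> A x^-1 }.

Definition generated A : set gT := smallest is_subgroup A.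

Definition lcoset (x : gT) A : set gT := [set x * a | a in A].

Definition lcosets G H : set (set gT) := [set lcoset g H | g in G].

Definition finite_index G H : Prop := H `<=` G /\ finite_set (lcosets G H).

Definition is_normal N G : Prop :=
  [/\ is_subgroup N, N `<=` G & forall g n, G g -> N n -> N (n ^ g)].

Definition just_infinite G : Prop :=
  forall N, is_normal N G -> N <> [set 1] -> finite_set (lcosets G N).

Definition virtually_abelian G : Prop :=
  exists A, [/\ is_subgroup A, finite_index G A &
                forall a b, A a -> A b -> commute a b].

Definition symmetric_generating_set S G : Prop :=
  [/\ finite_set S, forall s, S s -> S s^-1 & generated S = G].

Definition faithful_on_cosets G H : Prop :=
  forall g, G g -> (forall C, lcosets G H C -> lcoset g C = C) -> g = 1.

(* [act] is only required to be an action of the subgroup [G]; its values at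
   elements outside [G] are irrelevant. *)
Definition is_action (X : Type) G (act : gT -> X -> X) : Prop :=
  (forall x, act 1 x = x) /\
  (forall g h x, G g -> G h -> act (g * h) x = act g (act h x)).

Definition commensurated (X : Type) G (act : gT -> X -> X) (A : set X) : Prop :=
  forall g, G g -> finite_set ((act g @` A) `+` A).

Definition transfixed (X : Type) G (act : gT -> X -> X) (A : set X) : Prop :=
  exists B : set X,
    (forall g, G g -> act g @` B = B) /\ finite_set (A `+` B).

Definition property_FW G : Prop :=
  forall (X : Type) (act : gT -> X -> X), is_action G act ->
  forall A : set X, commensurated G act A -> transfixed G act A.

End Groups.

(* A quotient of [G] is presented as the image of a homomorphism [pi] on [G]. *)
Definition factors_through_virtually_abelian (gT : groupType) (G H : set gT) :
    Prop :=
  exists (qT : groupType) (pi : gT -> qT),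
    [/\ forall g h, G g -> G h -> pi (g * h) = pi g * pi h,
        virtually_abelian (pi @` G) &
        forall g h, G g -> G h -> pi g = pi h ->
          forall C, lcosets G H C -> lcoset g C = lcoset h C].

Record graph := Graph {
  carrier : Type;
  vertices : set carrier;
  edge : carrier -> carrier -> Prop }.
Arguments vertices : clear implicits.

Section Ends.
Variable Gam : graph.
Implicit Type Sig : set (carrier Gam).

Definition edge_off Sig (x y : carrier Gam) : Prop :=
  [/\ (vertices Gam `\` Sig) x, (vertices Gam `\` Sig) y & edge x y].

Definition component_off Sig (x : carrier Gam) : set (carrier Gam) :=
  [set y | clos_refl_sym_trans _ (edge_off Sig) x y].

Definition infinite_components Sig : set (set (carrier Gam)) :=
  [set C | (exists2 x, (vertices Gam `\` Sig) x & C = component_off Sig x)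
           /\ infinite_set C].

Definition end_counts : set nat :=
  [set n | exists Sig, [/\ Sig `<=` vertices Gam, finite_set Sig &
                           `I_n #<= infinite_components Sig]].

(* The supremum is taken in the naturals extended by [None], for infinity. *)
Definition num_ends : option nat :=
  if `[< has_ubound end_counts >] then Some (supremum 0%N end_counts) else None.

End Ends.

Definition enat_le (a b : option nat) : bool :=
  match a, b with
  | _, None => true
  | None, Some _ => false
  | Some m, Some n => (m <= n)%N
  end.

Definition one_ended (Gam : graph) : Prop := num_ends Gam = Some 1%N.

Definition schreier (gT : groupType) (G S H : set gT) : graph :=
  {| carrier := set gT;
     vertices := lcosets G H;
     edge := fun x y => exists2 s, S s & y = lcoset s x |}.

Record rooted_tree := RootedTree {
  vertex :> eqType;
  root : vertex;
  adj : rel vertex;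
  adj_sym : symmetric adj;
  adj_irr : irreflexive adj;
  adj_connected :
    forall v w, exists p : seq vertex, path adj v p /\ last v p = w;
  adj_acyclic : forall c : seq vertex, ucycle adj c -> (size c <= 2)%N }.

Section Trees.
Variable T : rooted_tree.
Implicit Types v w : T.

Definition has_path v w (n : nat) : Prop :=
  exists p : seq T, [/\ path (@adj T) v p, last v p = w & size p = n].

Lemma has_path_ex v w : exists n, `[< has_path v w n >].
Proof.
have [p [vp pw]] := adj_connected v w.
by exists (size p); apply/asboolP; exists p.
Qed.

Definition dist v w : nat := ex_minn (has_path_ex v w).

Definition level v : nat := dist (root T) v.

Definition neighbours v : set T := [set w | adj v w].

Definition locally_finite : Prop := forall v, finite_set (neighbours v).

Definition spherically_homogeneous : Prop :=
  forall v w, level v = level w -> neighbours v #= neighbours w.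

(* [w] descends from [v] when [v] lies on the geodesic from the root to [w]. *)
Definition subtree v : set T := [set w | level w = (level v + dist v w)%N].

Definition boundary : set (nat -> T) :=
  [set xi | xi 0%N = root T /\
            forall m n, (m <= n)%N -> dist (xi m) (xi n) = (n - m)%N].

(* The cylinders [cylinder xi n] form a basis of neighbourhoods of [xi]. *)
Definition cylinder (xi : nat -> T) (n : nat) : set (nat -> T) :=
  [set eta | boundary eta /\ eta n = xi n].

Definition boundary_nbhs (xi : nat -> T) (U : set (nat -> T)) : Prop :=
  U `<=` boundary /\ exists n, cylinder xi n `<=` U.

Record tree_aut := TreeAut {
  aut_fun :> T -> T;
  aut_bij : bijective aut_fun;
  aut_adj : forall v w, adj (aut_fun v) (aut_fun w) = adj v w;
  aut_root : aut_fun (root T) = root T }.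

HB.instance Definition _ := gen_eqMixin tree_aut.
HB.instance Definition _ := gen_choiceMixin tree_aut.

Lemma tree_aut_ext (f g : tree_aut) : f =1 g -> f = g.
Proof.
case: f g => [f fb fa fr] [g gb ga gr] /= /funext fg; subst g.
by congr TreeAut; apply: Prop_irrelevance.
Qed.

Definition aut_one : tree_aut :=
  @TreeAut id (Bijective (fun=> erefl) (fun=> erefl)) (fun _ _ => erefl) erefl.

Lemma aut_mul_adj (f g : tree_aut) v w :
  adj ((f \o g) v) ((f \o g) w) = adj v w.
Proof. by rewrite /= !aut_adj. Qed.

Lemma aut_mul_root (f g : tree_aut) : (f \o g) (root T) = root T.
Proof. by rewrite /= !aut_root. Qed.

Definition aut_mul (f g : tree_aut) : tree_aut :=
  TreeAut (bij_comp (aut_bij f) (aut_bij g))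
          (aut_mul_adj f g) (aut_mul_root f g).

Lemma aut_inv_ex (f : tree_aut) :
  exists g : tree_aut, cancel f g /\ cancel g f.
Proof.
have [g fK gK] := aut_bij f.
have gb : bijective g by exists f.
have ga v w : adj (g v) (g w) = adj v w by rewrite -(aut_adj f) !gK.
have gr : g (root T) = root T by rewrite -{1}(aut_root f) fK.
by exists (TreeAut gb ga gr).
Qed.

Definition aut_inv (f : tree_aut) : tree_aut := sval (cid (aut_inv_ex f)).

Lemma aut_mulA : associative aut_mul.
Proof. by move=> f g h; apply: tree_aut_ext. Qed.

Lemma aut_mul1 : left_id aut_one aut_mul.
Proof. by move=> f; apply: tree_aut_ext. Qed.

Lemma aut_1mul : right_id aut_one aut_mul.
Proof. by move=> f; apply: tree_aut_ext. Qed.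

Lemma aut_mulV : left_inverse aut_one aut_inv aut_mul.
Proof.
move=> f; apply: tree_aut_ext => v /=.
by rewrite /aut_inv; case: cid => g [/= fK _]; apply: fK.
Qed.

Lemma aut_Vmul : right_inverse aut_one aut_inv aut_mul.
Proof.
move=> f; apply: tree_aut_ext => v /=.
by rewrite /aut_inv; case: cid => g [/= _ gK]; apply: gK.
Qed.

HB.instance Definition _ :=
  isGroup.Build tree_aut aut_mulA aut_mul1 aut_1mul aut_mulV aut_Vmul.

Implicit Type G : set tree_aut.

Definition level_transitive G : Prop :=
  forall v w, level v = level w -> exists2 g, G g & g v = w.

Definition rist G v : set tree_aut :=
  [set g | G g /\ forall w, ~ subtree v w -> g w = w].

Definition rist_level G (n : nat) : set tree_aut :=
  generated (\bigcup_(v in [set v | level v = n]) rist G v).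

Definition is_branch G : Prop :=
  level_transitive G /\ forall n, finite_index G (rist_level G n).

(* An automorphism [g] maps the ray [xi] to the ray [g \o xi]. *)
Definition stabiliser G (xi : nat -> T) : set tree_aut :=
  [set g | G g /\ g \o xi = xi].

Definition germ_stabiliser G (xi : nat -> T) : set tree_aut :=
  [set g | stabiliser G xi g /\
           exists U, boundary_nbhs xi U /\
                     forall eta, U eta -> g \o eta = eta].

Definition germs G (xi : nat -> T) : set (set tree_aut) :=
  lcosets (stabiliser G xi) (germ_stabiliser G xi).

Definition graph_of_germs G S (xi : nat -> T) : graph :=
  schreier G S (germ_stabiliser G xi).

End Trees.
Arguments boundary : clear implicits.

(* Main.v *)
(* Let A be a commensurated subset of G/H, infinite with infinite complement.  If K
   and L are commuting finitely generated subgroups with KL of finite index in G,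
   then KH or LH contains a finite-index subgroup of G: otherwise almost all
   K-orbits and L-orbits in the KL-orbit of H lie in A or in its complement, and
   since each K-orbit there meets each L-orbit, they all lie on the same side.
   Taking for K and L the rigid stabilizers of two complementary sets of vertices
   of one level, call J small if the fixer of the subtrees below J is not big in
   this sense; any two small sets of one level then meet.  If H contains no
   nontrivial normal subgroup of G, every level has a small pair of vertices,
   since otherwise iterated commutators would produce such a subgroup.  Koenig's
   lemma gives a pair of rays, and moving them by elements of H shows that one of
   them, xi, is already small; then H fixes xi.
   The fixer K of the subtree below a vertex of xi is normalized by G_xi.  Almost
   every fibre of G/H -> G/HK lies in A or in its complement, and both cases occur;
   lifting a simple path of G/HK between two such fibres bounds the size of HK/H by
   that of the boundary of A.  The bound does not depend on K, so the orbit of H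
   under the germ stabilizer is finite and H has finite index in G_xi.  The same
   purity of fibres turns disjoint commensurated sets of G/H into disjoint
   commensurated sets of the graph of germs.
   For Property FW, a finitely generated infinite virtually abelian quotient has
   a two-ended coset space, and conversely a commensurated set meets almost every
   orbit in the whole orbit or not at all. *)
Require Import Defs.
From HB Require Import structures.
From Stdlib Require Import Relation_Operators.
From mathcomp Require Import all_boot all_order.
From mathcomp Require Import boolp classical_sets functions cardinality.

Set Implicit Arguments.
Unset Strict Implicit.
Unset Printing Implicit Defensive.

Local Open Scope classical_set_scope.

(** * Finite sets *)

Section FiniteSets.

(** An injective colouring by a [finType] is the working form of finiteness: pigeonhole arguments
    then combine through products and function types of colours. *)
Lemma finite_color (Y : Type) (D : set Y) (I : finType) (c : Y -> I) :
  (forall x y, D x -> D y -> c x = c y -> x = y) -> finite_set D.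
Proof.
move=> cI.
have -> : D = \bigcup_(i in [set: I]) [set x | D x /\ c x = i].
  by apply/seteqP; split => [x Dx|x [i _ []]] //; exists (c x).
apply: bigcup_finite => [|i _]; first exact: finite_finset.
have [[x [Dx xi]]|no] := pselect (exists x, D x /\ c x = i).
  apply: (sub_finite_set _ (finite_set1 x)) => y [Dy yi].
  by apply: cI => //; rewrite yi.
apply: (sub_finite_set _ (finite_set0 Y)) => y yi; apply: no; by exists y.
Qed.

Lemma finite_colorV (Y : Type) (D : set Y) : finite_set D ->
  exists (I : finType) (c : Y -> I), forall x y, D x -> D y -> c x = c y -> x = y.
Proof.
elim/Pchoice: Y => Y in D *.
move=> /finite_seqP[s ->]; exists 'I_(size s).+1, (fun x => inord (index x s)).
move=> x y /= xs ys /(congr1 val) /=.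
rewrite !inordK ?ltnS ?index_size // => e.
by rewrite -(nth_index x xs) e nth_index.
Qed.

Lemma finite_rel (X Y : Type) (A : set X) (B : set Y) (r : X -> Y -> Prop) :
  finite_set A -> (forall x, A x -> finite_set [set y | r x y]) ->
  (forall y, B y -> exists2 x, A x & r x y) -> finite_set B.
Proof.
move=> fA fr BA; apply: (sub_finite_set _ (bigcup_finite fA fr)) => y /BA[x Ax xy].
by exists x.
Qed.

Lemma finite_inv (X Y : Type) (A : set X) (B : set Y) (r : X -> Y) :
  finite_set A -> (forall y, B y -> exists2 x, A x & r x = y) -> finite_set B.
Proof.
move=> fA BA; apply: (sub_finite_set _ (finite_image r fA)) => y /BA[x Ax xy].
by exists x.
Qed.

Lemma infinite_uniq (X : eqType) (A : set X) n : infinite_set A ->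
  exists s : seq X, [/\ uniq s, size s = n & forall x, x \in s -> A x].
Proof.
move=> infA; elim: n => [|n [s [us ss sA]]]; first by exists [::].
have [x Ax xs] : exists2 x, A x & x \notin s.
  apply: contrapT => no; apply: infA; apply: (sub_finite_set _ (finite_seq s)) => x Ax.
  by apply: contrapT => /negP xs; apply: no; exists x.
exists (x :: s); rewrite /= xs us ss; split => // z; rewrite inE => /orP[/eqP->//|].
exact: sA.
Qed.

Lemma koenig (Y : Type) (par : Y -> Y) (P : nat -> set Y) :
  (forall n, finite_set (P n)) -> (forall n, P n !=set0) ->
  (forall n y, P n.+1 y -> P n (par y)) ->
  exists f : nat -> Y, forall n, P n (f n) /\ par (f n.+1) = f n.
Proof.
move=> Pfin Pne Ppar.
(* [E n y] says that [y] has descendants at every deeper level; the pigeonhole principle [pig]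
   starts it at level 0 and hands it on to a child. *)
pose E n y := P n y /\ forall k, exists2 z, P (n + k)%N z & iter k par z = y.
have pig n (D : set Y) (Q : nat -> set Y) : D `<=` P n ->
    (forall k, exists2 d, D d & Q k d) -> (forall k d, Q k.+1 d -> Q k d) ->
    exists2 d, D d & forall k, Q k d.
  move=> DP DQ Qanti; apply: contrapT => no.
  have Qle k l d : (k <= l)%N -> Q l d -> Q k d.
    by move=> /subnK <-; elim: (l - k)%N => //= j ih /Qanti.
  have bad d : exists k, D d -> ~ Q k d.
    apply: contrapT => /forallNP h; apply: no; exists d.
      by apply: contrapT => nD; apply: (h 0%N).
    by move=> k; apply: contrapT => nQ; apply: (h k).
  have [K HK] := choice bad.
  have [s Hs] : exists s : seq nat, forall d, D d -> K d \in s.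
    have /finite_seqP[s Es] := finite_image K (sub_finite_set DP (Pfin n)).
    by exists s => d Dd; have : [set` s] (K d) by rewrite -Es; exists d.
  (* At the largest failure index [K d] all elements of [D] fail at once. *)
  have [d Dd Qd] := DQ (\max_(i <- s) i).
  apply: (HK d Dd); apply: Qle Qd.
  by apply: (@leq_bigmax_seq _ s xpredT id (K d)) => //; apply: Hs.
have E0 : exists y, E 0%N y.
  have [//|||y Py Ey] := pig 0%N (P 0%N)
    (fun k y => exists2 z, P k z & iter k par z = y).
  - move=> k; have [z Pz] := Pne k; exists (iter k par z); last by exists z.
    by elim: k z Pz => //= k ih z Pz; rewrite -iterS iterSr; apply/ih/Ppar.
  - by move=> k d [z Pz <-]; exists (par z); rewrite ?iterSr //; apply: Ppar.
  by exists y; split => // k; have [z Pz zy] := Ey k; exists z.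
have step n y : exists z, E n y -> E n.+1 z /\ par z = y.
  have [Ey|?] := pselect (E n y); last by exists y.
  have [|||z [Pz zy] Ez] := pig n.+1 [set z | P n.+1 z /\ par z = y]
    (fun k y => exists2 z, P (n.+1 + k)%N z & iter k par z = y).
  - by move=> z [].
  - move=> k; have [z Pz zy] := Ey.2 k.+1; exists (iter k par z); last first.
      by exists z => //; rewrite addSnnS.
    split; last exact: zy.
    rewrite addnS -addSn in Pz; elim: k z Pz {zy} => [|k ih] z; first by rewrite addn0.
    by rewrite addnS => /Ppar/ih; rewrite -iterSr.
  - by move=> k d [z Pz <-]; exists (par z);
      rewrite ?iterSr //; apply: Ppar; rewrite -addnS.
  by exists z => _; split.
have [y0 Ey0] := E0.
have [nx Hnx] := choice (fun p : nat * Y => step p.1 p.2).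
pose F := fix F n := if n is m.+1 then nx (m, F m) else y0.
have EF n : E n (F n) by elim: n => //= n ih; have [] := Hnx (n, F n) ih.
exists F => n; split; first by have [] := EF n.
by have [] := Hnx (n, F n) (EF n).
Qed.

End FiniteSets.

Ltac grp :=
  repeat match goal with
  | H : ?P |- ?P => exact H
  | |- ?A 1%g => apply: subgroup1
  | |- ?A (_ * _)%g => apply: subgroupM
  | |- ?A (_^-1)%g => apply: subgroupV
  | KG : (?K `<=` ?G)%classic, Kx : ?K ?x |- ?G ?x => exact: (KG _ Kx)
  end.
Ltac gsimp :=
  rewrite ?(invgM, invgK, invg1, mulgA, mul1g, mulg1, mulgK, mulgVK, mulVg, mulgV).

(** * Subgroups of finite index *)

Section Groups.
Local Open Scope group_scope.
Variable gT : groupType.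
Implicit Types (A B G H K L M N R S : set gT).

(* Elements of [G] of the same colour lie in the same left coset of [M]; unlike
   [finite_index], this does not require [M] to be a subset of [G]. *)
Definition fin_index G M : Prop := exists (I : finType) (f : gT -> I),
  forall x y, G x -> G y -> f x = f y -> M (x^-1 * y).

Definition fin_gen K : Prop :=
  exists S, [/\ finite_set S, S `<=` K & K `<=` generated S].

Definition prodg K L : set gT := [set g | exists k l, [/\ K k, L l & g = k * l]].

Definition core G M : set gT :=
  [set n | G n /\ forall x, G x -> M (x^-1 * n * x)].

Lemma generated_sub S B : is_subgroup B -> S `<=` B -> generated S `<=` B.
Proof. by move=> sB SB x; apply. Qed.

Lemma generated_gen S : S `<=` generated S.
Proof. by move=> x Sx B [_]; apply. Qed.

Lemma generated_subgroup S : is_subgroup (generated S).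
Proof.
split => [B [sB _]|x y Sx Sy B sB|x Sx B sB]; first exact: subgroup1.
  by apply: (subgroupM sB.1); [apply: Sx|apply: Sy].
by apply: (subgroupV sB.1); apply: Sx.
Qed.

Lemma fiS G G' M M' : G' `<=` G -> M `<=` M' -> fin_index G M -> fin_index G' M'.
Proof. by move=> sG sM [I [f fM]]; exists I, f => x y /sG Gx /sG Gy /(fM _ _ Gx Gy)/sM. Qed.

Lemma fiI G M M' : fin_index G M -> fin_index G M' -> fin_index G (M `&` M').
Proof.
move=> [I [f fM]] [J [f' fM']]; exists (I * J)%type, (fun x => (f x, f' x)).
by move=> x y Gx Gy [/fM e /fM' e']; split; [apply: e|apply: e'].
Qed.

(** Colours that do not occur in [G] get the default representative [1], whence the premise
    [G 1]. *)
Lemma fi_rep G (I : finType) (f : gT -> I) : G 1 ->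
  exists t : I -> gT, (forall i, G (t i)) /\ forall x, G x -> f (t (f x)) = f x.
Proof.
move=> G1; have rep i : exists t, G t /\ forall x, G x -> f x = i -> f t = i.
  have [[x [Gx xi]]|no] := pselect (exists x, G x /\ f x = i); first by exists x.
  by exists 1; split => // x Gx xi; case: no; exists x.
have [t Ht] := choice rep; exists t; split => [i|x Gx]; first by have [] := Ht i.
exact: (Ht (f x)).2 x Gx erefl.
Qed.

(** An element is coloured by its colour for [B], paired with the colour in [B] of its quotient by
    the representative of that first colour. *)
Lemma fi_trans G B M : is_subgroup G -> fin_index G B -> fin_index B M -> fin_index G M.
Proof.
move=> sG [I [f fB]] [J [h hM]].
have [t [Gt ft]] := fi_rep f (subgroup1 sG).
exists (I * J)%type, (fun x => (f x, h ((t (f x))^-1 * x))) => x y Gx Gy [e].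
rewrite -e => /hM; gsimp; apply.
  by apply: fB => //; apply: ft.
by apply: fB => //; rewrite e; apply: ft.
Qed.

Lemma core_subgroup G M : is_subgroup G -> is_subgroup M -> is_subgroup (core G M).
Proof.
move=> sG sM; split => [|x y [Gx Mx] [Gy My]|x [Gx Mx]]; split.
- exact: subgroup1.
- by move=> x Gx; gsimp; apply: subgroup1.
- exact: subgroupM.
- move=> z Gz; have := subgroupM sM (Mx z Gz) (My z Gz); by gsimp.
- exact: subgroupV.
- by move=> z Gz; have := subgroupV sM (Mx z Gz); gsimp.
Qed.

Lemma core_conj G M n x : is_subgroup G -> core G M n -> G x ->
  core G M (x^-1 * n * x).
Proof.
move=> sG [Gn Mn] Gx; split => [|y Gy].
  by apply: (subgroupM sG) => //; apply: (subgroupM sG) => //; apply: subgroupV.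
by have := Mn (x * y) (subgroupM sG Gx Gy); gsimp.
Qed.

Lemma core_sub G M : is_subgroup G -> core G M `<=` M.
Proof. by move=> sG n [_ /(_ 1 (subgroup1 sG))]; gsimp. Qed.

(** Colour [n] by the map it induces on the cosets of [M], read off from the products [n * t i];
    elements with equal maps differ by an element of the core. *)
Lemma fi_core G M : is_subgroup G -> is_subgroup M -> fin_index G M -> fin_index G (core G M).
Proof.
move=> sG sM [I [f fM]]; have [t [Gt ft]] := fi_rep f (subgroup1 sG).
exists {ffun I -> I}, (fun n => [ffun i => f (n * t i)]) => n n' Gn Gn' /ffunP e.
split => [|x Gx]; first by apply: (subgroupM sG) => //; apply: subgroupV.
have Mtx : M ((t (f x))^-1 * x) by apply: fM => //; apply: ft.
have : M ((n * t (f x))^-1 * (n' * t (f x))).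
  by apply: fM; [apply: subgroupM..|have := e (f x); rewrite !ffunE].
move=> Mm; have := subgroupM sM (subgroupM sM (subgroupV sM Mtx) Mm) Mtx.
by gsimp.
Qed.

Lemma lcosetP x A y : lcoset x A y <-> A (x^-1 * y).
Proof.
split => [[a Aa <-]|Aa]; first by gsimp.
by exists (x^-1 * y) => //; gsimp.
Qed.

Lemma lcosetM x y A : lcoset (x * y) A = lcoset x (lcoset y A).
Proof. by apply/seteqP; split => z; rewrite !lcosetP; gsimp. Qed.

Lemma lcoset1 A : lcoset 1 A = A.
Proof. by apply/seteqP; split => z; rewrite !lcosetP; gsimp. Qed.

Lemma lcoset_eq x y H : is_subgroup H -> lcoset x H = lcoset y H <-> H (x^-1 * y).
Proof.
move=> sH; split => [e|Hxy].
  by apply/lcosetP; rewrite e; apply/lcosetP; gsimp; apply: subgroup1.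
apply/seteqP; split => z; rewrite !lcosetP => Hz.
  by have := subgroupM sH (subgroupV sH Hxy) Hz; gsimp.
by have := subgroupM sH Hxy Hz; gsimp.
Qed.

Lemma fi_lcosets G M : is_subgroup M -> fin_index G M <-> finite_set (lcosets G M).
Proof.
move=> sM; split => [[I [f fM]]|].
  have rc C : exists c, lcosets G M C -> G c /\ lcoset c M = C.
    have [[x Gx xC]|no] := pselect (lcosets G M C); first by exists x.
    by exists 1.
  have [c cP] := choice rc.
  apply: (@finite_color _ _ I (fun C => f (c C))) => C D GC GD e.
  have [Gx xC] := cP _ GC; have [Gy yD] := cP _ GD.
  rewrite -xC -yD; apply/lcoset_eq => //; exact: fM.
move=> /finite_colorV[I [c cI]]; exists I, (fun x => c (lcoset x M)) => x y Gx Gy e.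
by apply/lcoset_eq => //; apply: cI => //; [exists x|exists y].
Qed.

Lemma fi_finite G M : is_subgroup G -> fin_index G M -> finite_set M -> finite_set G.
Proof.
move=> sG fM /finite_colorV[J [c cI]].
have fM1 : fin_index M [set 1].
  by exists J, c => x y Mx My /(cI _ _ Mx My) ->; gsimp.
have [I [f fI]] := fi_trans sG fM fM1.
by apply: (@finite_color _ _ I f) => x y Gx Gy /(fI _ _ Gx Gy) /mulg1_eq; rewrite invgK.
Qed.

Lemma fi_pigeon G M K : fin_index G M -> K `<=` G -> infinite_set K ->
  exists x y, [/\ K x, K y, x <> y & M (x^-1 * y)].
Proof.
move=> [I [f fM]] KG; apply: contra_notP => no; apply: (@finite_color _ _ I f).
move=> x y Kx Ky e; apply: contrapT => xy; apply: no; exists x, y; split => //.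
by apply: fM => //; apply: KG.
Qed.

Lemma prodg_subgroup K L : is_subgroup K -> is_subgroup L ->
  (forall k l, K k -> L l -> k * l = l * k) -> is_subgroup (prodg K L).
Proof.
move=> sK sL KL; split.
- by exists 1, 1; split; [apply: subgroup1..|gsimp].
- move=> _ _ [k [l [Kk Ll ->]]] [k' [l' [Kk' Ll' ->]]].
  exists (k * k'), (l * l'); split; [exact: subgroupM..|].
  by rewrite -!mulgA (mulgA l) -(KL k') // !mulgA.
- move=> _ [k [l [Kk Ll ->]]]; exists k^-1, l^-1.
  by split; [exact: subgroupV..|rewrite invgM KL //; exact: subgroupV].
Qed.

(** Schreier's lemma. The generators are the elements of [R] of the form [(t i)^-1 * s * t j],
    together with the representatives lying in [R], since [t (f 1)] may differ from [1]. *)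
Lemma fg_fi G R : is_subgroup G -> is_subgroup R -> R `<=` G ->
  fin_gen G -> fin_index G R -> fin_gen R.
Proof.
move=> sG sR RG [S [finS SG GS]] [I [f fR]].
have [t [Gt ft]] := fi_rep f (subgroup1 sG).
pose U : set gT := [set r | R r /\ ((exists j, r = t j) \/
  (exists p : I * I, exists2 s, S s & r = (t p.1)^-1 * s * t p.2))].
exists U; split; [|by move=> x []|].
  apply: (@sub_finite_set _ _ ((t @` setT) `|`
     \bigcup_(p in [set: (I * I)%type]) ((fun s => (t p.1)^-1 * s * t p.2) @` S))).
    move=> r [_ [[j ->]|[p [s Ss ->]]]]; first by left; exists j.
    by right; exists p => //; exists s.
  rewrite finite_setU; split; first by apply: finite_image; apply: finite_finset.
  by apply: bigcup_finite => [|p _]; [apply: finite_finset|apply: finite_image].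
have sB := generated_subgroup U; have BR : generated U `<=` R.
  by apply: generated_sub => // x [].
(* [P g] says that [g] maps every [t i] into some coset of [generated U] represented by a [t j]. It
   is carried for [g^-1] as well, so that the elements concerned form a subgroup. *)
pose P g := forall i, exists j, generated U ((t j)^-1 * g * t i).
have PG : G `<=` [set g | P g /\ P g^-1].
  move=> g /GS; apply: generated_sub => [|s Ss].
    split => [|x y [Px Px'] [Py Py']|x [Px Px']].
    - by split => i; exists i; gsimp; apply: subgroup1.
    - split => i.
        have [j Bj] := Py i; have [k Bk] := Px j; exists k.
        by have := subgroupM sB Bk Bj; gsimp.
      have [j Bj] := Px' i; have [k Bk] := Py' j; exists k.
      by have := subgroupM sB Bk Bj; gsimp.
    - by split => //; rewrite invgK.
  have Gs := SG _ Ss; split => i.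
    have Gst : G (s * t i) by apply: subgroupM.
    exists (f (s * t i)); apply: generated_gen; split; last first.
      by right; exists (f (s * t i), i), s.
    rewrite -mulgA; apply: fR => //; exact: ft.
  have Gst : G (s^-1 * t i) by apply: subgroupM => //; apply: subgroupV.
  exists (f (s^-1 * t i)); rewrite -[X in generated U X]invgK.
  apply: (subgroupV sB); apply: generated_gen; split; last first.
    by right; exists (i, f (s^-1 * t i)), s; rewrite //; gsimp.
  apply: (subgroupV sR); rewrite -mulgA; apply: fR => //; exact: ft.
(* Here [r * t (f 1)] is [t j] times an element of [generated U], and both representatives lie in
   [R], hence in [U]. *)
move=> r Rr; have [j Bj] := (PG r (RG _ Rr)).1 (f 1).
have R1 : R (t (f 1)).
  have := @fR 1 (t (f 1)) (subgroup1 sG) (Gt _); gsimp; apply.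
  by rewrite ft //; apply: subgroup1.
have Rj : R (t j).
  have := subgroupM sR (subgroupM sR Rr R1) (subgroupV sR (BR _ Bj)); by gsimp.
have Bt i : R (t i) -> generated U (t i).
  by move=> Ri; apply: generated_gen; split => //; left; exists i.
have := subgroupM sB (subgroupM sB (Bt _ Rj) Bj) (subgroupV sB (Bt _ R1)).
by gsimp.
Qed.

(** The product is direct, so the [K]-components of its generators generate [K]. *)
Lemma fg_factor K L : is_subgroup K -> is_subgroup L ->
  (forall k l, K k -> L l -> k * l = l * k) -> (forall x, K x -> L x -> x = 1) ->
  fin_gen (prodg K L) -> fin_gen K.
Proof.
move=> sK sL KL KL1 [S [finS SKL KLS]].
have pr x : exists k, S x -> K k /\ L (k^-1 * x).
  have [/SKL[k [l [Kk Ll ->]]]|no] := pselect (S x); last by exists 1.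
  by exists k => _; gsimp.
have [k kP] := choice pr.
exists (k @` S); split; first exact: finite_image.
  by move=> _ [x Sx <-]; have [] := kP x Sx.
set B := generated _; have sB : is_subgroup B by apply: generated_subgroup.
have BK : B `<=` K by apply: generated_sub => // _ [x Sx <-]; have [] := kP x Sx.
have sP : is_subgroup (prodg B L).
  by apply: prodg_subgroup => // x y /BK; apply: KL.
move=> x Kx; have : generated S x.
  by apply: KLS; exists x, 1; split => //; [apply: subgroup1|gsimp].
move=> /(generated_sub sP)[].
  move=> s Ss; have [_ Ls] := kP s Ss; exists (k s), ((k s)^-1 * s).
  by split => //; [apply: generated_gen; exists s|gsimp].
move=> b [l [Bb Ll e]]; suff l1 : l = 1 by rewrite e l1 mulg1.
apply: KL1 => //; have -> : l = b^-1 * x by rewrite e; gsimp.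
by apply: (subgroupM sK) => //; apply: (subgroupV sK); apply: BK.
Qed.

End Groups.

(** * Commensurated sets and commuting subgroups *)

Section Actions.
Local Open Scope group_scope.
Variables (gT : groupType) (G : set gT) (X : Type) (act : gT -> X -> X).
Hypotheses (sG : is_subgroup G) (actP : is_action G act).
Implicit Types (A V : set X) (H K L M N R S : set gT) (x y z : X).

Lemma act1 x : act 1 x = x. Proof. exact: actP.1. Qed.

Lemma actM g h x : G g -> G h -> act (g * h) x = act g (act h x).
Proof. exact: actP.2. Qed.

Lemma actK g x : G g -> act g^-1 (act g x) = x.
Proof. by move=> Gg; rewrite -actM ?mulVg ?act1 //; apply: subgroupV. Qed.

Lemma actVK g x : G g -> act g (act g^-1 x) = x.
Proof. by move=> Gg; rewrite -actM ?mulgV ?act1 //; apply: subgroupV. Qed.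

(** A one-sided form of commensuration: the other half of the symmetric difference is the same
    condition for [g^-1]. *)
Definition almost_invariant A : Prop :=
  forall g, G g -> finite_set [set x | A x /\ ~ A (act g x)].

Lemma commensuratedP A : commensurated G act A <-> almost_invariant A.
Proof.
split => cA g Gg.
  apply: (finite_inv (r := act g^-1) (cA g Gg)) => x [Ax nA].
  by exists (act g x); [left; split => //; exists x|apply: actK].
rewrite /setY finite_setU; split.
  apply: (finite_inv (r := act g) (cA g Gg)) => _ [[x Ax <-] nA].
  by exists x.
apply: (finite_inv (r := id) (cA g^-1 (subgroupV sG Gg))) => x [Ax nA].
exists x => //; split => // Agx; apply: nA; exists (act g^-1 x) => //.
exact: actVK.
Qed.

Lemma almost_invariantC A : almost_invariant A -> almost_invariant (~` A).
Proof.
move=> cA g Gg; apply: (finite_inv (r := act g^-1) (cA _ (subgroupV sG Gg))).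
move=> x [nAx /contrapT Agx]; exists (act g x); last exact: actK.
by split => //; rewrite actK.
Qed.

Lemma almost_invariant_act A t : G t -> almost_invariant A ->
  almost_invariant [set x | A (act t x)].
Proof.
move=> Gt cA g Gg; have Gtg : G (t * g * t^-1).
  by apply: subgroupM => //; [apply: subgroupM|apply: subgroupV].
apply: (finite_inv (r := act t^-1) (cA _ Gtg)) => x [/= Ax nA].
exists (act t x); last exact: actK.
by split => //; rewrite -actM // mulgVK actM.
Qed.

(** [V] collects the points that some generator of [K] moves across the boundary of [A]; a [K]-orbit
    avoiding it stays on one side. *)
Lemma pure_orbits A K : is_subgroup K -> K `<=` G -> fin_gen K -> almost_invariant A ->
  exists2 V, finite_set V & forall x, (forall k, K k -> ~ V (act k x)) ->
    forall k, K k -> (A (act k x) <-> A x).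
Proof.
move=> sK KG [S [finS SK KS]] cA; have cA' := almost_invariantC cA.
exists (\bigcup_(s in S) ([set x | A x /\ ~ A (act s x)] `|`
                          [set x | ~ A x /\ ~ ~ A (act s x)])).
  by apply: bigcup_finite => // s /SK/KG Gs; rewrite finite_setU; split;
    [apply: cA|apply: cA'].
move=> x Vx; pose B := [set b | K b /\
  forall k, K k -> (A (act (b * k) x) <-> A (act k x))].
have sB : is_subgroup B.
  split => [|b c [Kb Hb] [Kc Hc]|b [Kb Hb]]; split.
  - exact: subgroup1.
  - by move=> k Kk; rewrite mul1g.
  - exact: subgroupM.
  - by move=> k Kk; rewrite -mulgA Hb ?Hc //; apply: subgroupM.
  - exact: subgroupV.
  - by move=> k Kk; rewrite -Hb ?mulVKg //; apply: subgroupM => //; apply: subgroupV.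
have KB : K `<=` B.
  move=> k /KS; apply: generated_sub => // s Ss; split => [|c Kc]; first exact: SK.
  rewrite actM; [|exact/KG/SK|exact: KG].
  have [Ax|nAx] := pselect (A (act c x)); split => // H.
    by apply: contrapT => nA; apply: (Vx c Kc); exists s => //; left.
  by case: (Vx c Kc); exists s => //; right; split => // nA; apply: nA.
by move=> k /KB[_ /(_ 1 (subgroup1 sK))]; rewrite mulg1 act1.
Qed.

Variable y : X.

(* That is, [L * Stab(y)] contains a finite-index subgroup of [G]. *)
Definition big L : Prop := exists M, [/\ is_subgroup M, M `<=` G, fin_index G M &
  forall g, M g -> exists2 l, L l & act g y = act l y].

Lemma bigS L L' : L `<=` L' -> big L -> big L'.
Proof.
move=> LL [M [sM MG fM HM]]; exists M; split => // g /HM[l Ll e].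
by exists l => //; apply: LL.
Qed.

(** As [R] normalizes [L], it permutes the [L]-orbits, and the set is the stabilizer in [R] of the
    [L]-orbit of [y]. *)
Lemma big_subgroup R L : is_subgroup R -> R `<=` G -> is_subgroup L -> L `<=` G ->
  (forall r l, R r -> L l -> L (r^-1 * l * r)) ->
  is_subgroup [set g | R g /\ exists2 l, L l & act g y = act l y].
Proof.
move=> sR RG sL LG RL.
have RL' r l : R r -> L l -> L (r * l * r^-1).
  by move=> Rr Ll; have := RL r^-1 l (subgroupV sR Rr) Ll; rewrite invgK.
split => [|g h [Rg [l Ll eg]] [Rh [m Lm eh]]|g [Rg [l Ll eg]]]; split.
- exact: subgroup1.
- by exists 1 => //; apply: subgroup1.
- exact: subgroupM.
- have Gg := RG _ Rg; have Gh := RG _ Rh; have Gl := LG _ Ll; have Gm := LG _ Lm.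
  exists (g * m * g^-1 * l); first by apply: subgroupM => //; apply: RL'.
  by rewrite !actM; try grp; rewrite eh -eg actK.
- exact: subgroupV.
- have Gg := RG _ Rg; have Gl := LG _ Ll; have Gg' := subgroupV sG Gg.
  exists ((g^-1 * l * g)^-1); first by apply: (subgroupV sL); apply: RL.
  have Gl' := subgroupV sG Gl.
  gsimp; rewrite !actM //; last by apply: subgroupM.
  by rewrite eg actK.
Qed.

(** For [g] in [M] choose [l] in [L] with the same effect on [y] and colour [g] by the coset of [l]
    modulo [L']. Two elements of one colour differ by an element stabilizing the [L']-orbit of [y],
    because [R] normalizes [L']. *)
Lemma big_fi L L' R : is_subgroup L -> L `<=` G -> is_subgroup L' -> L' `<=` L ->
  fin_index L L' -> is_subgroup R -> R `<=` G -> fin_index G R ->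
  (forall r l, R r -> L' l -> L' (r^-1 * l * r)) -> big L -> big L'.
Proof.
move=> sL LG sL' L'L [I [f fL]] sR RG fR RL' [M [sM MG fM HM]].
have L'G : L' `<=` G by move=> l /L'L/LG.
exists [set g | R g /\ exists2 l, L' l & act g y = act l y].
split => [||| g []] //; first exact: big_subgroup.
  by move=> g [/RG].
apply: (fi_trans sG (fiI fM fR)).
have lP g : exists l, M g -> L l /\ act g y = act l y.
  by have [/HM[l Ll e]|no] := pselect (M g); [exists l|exists 1].
have [l Hl] := choice lP.
exists I, (fun g => f (l g)^-1) => g h [Mg Rg] [Mh Rh] e.
have [Lg eg] := Hl _ Mg; have [Lh eh] := Hl _ Mh.
have := fL _ _ (subgroupV sL Lg) (subgroupV sL Lh) e; rewrite invgK => L'c.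
have [Gg Gh Glg Glh] : [/\ G g, G h, G (l g) & G (l h)].
  by split; [apply: RG|apply: RG|apply: LG|apply: LG].
have [Gg' Glg' Glh'] : [/\ G g^-1, G (l g)^-1 & G (l h)^-1].
  by split; apply: subgroupV.
split; first by apply: subgroupM => //; apply: subgroupV.
exists (g^-1 * (l g * (l h)^-1)^-1 * g).
  by apply: RL' => //; apply: (subgroupV sL').
by rewrite invgM invgK !actM; try grp; rewrite eg actK ?eh.
Qed.

Lemma big_conj L L' h : L `<=` G -> G h -> act h y = y ->
  (forall l, L l -> L' (h * l * h^-1)) -> big L -> big L'.
Proof.
move=> LG Gh hy LL' [M [sM MG [I [f fM]] HM]]; have Gh' := subgroupV sG Gh.
have Gc g : G g -> G (h^-1 * g * h) by move=> Gg; grp.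
exists [set g | G g /\ M (h^-1 * g * h)]; split.
- split => [|g g' [Gg Mg] [Gg' Mg']|g [Gg Mg]]; split.
  + exact: subgroup1.
  + by gsimp; apply: subgroup1.
  + exact: subgroupM.
  + by have := subgroupM sM Mg Mg'; gsimp.
  + exact: subgroupV.
  + by have := subgroupV sM Mg; gsimp.
- by move=> g [].
- exists I, (fun g => f (h^-1 * g * h)) => g g' Gg Gg' /(fM _ _ (Gc _ Gg) (Gc _ Gg')).
  move=> Mc; split; last by move: Mc; gsimp.
  by apply: subgroupM => //; apply: subgroupV.
- move=> g [Gg /HM[l Ll e]]; exists (h * l * h^-1); first exact: LL'.
  have Gl := LG _ Ll; have hy' : act h^-1 y = y by rewrite -{1}hy actK.
  by rewrite !actM; try grp; rewrite hy' -e !actM; try grp; rewrite hy actVK.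
Qed.

(** The form in which bigness enters [pure_fibres], where only the finitely many translates by [F]
    have to be treated. *)
Lemma big_cover L : L `<=` G -> big L ->
  exists F, [/\ finite_set F, F `<=` G & forall g, G g ->
     exists t l, [/\ F t, L l & act g y = act t (act l y)]].
Proof.
move=> LG [M [sM MG [I [f fM]] HM]]; have [t [Gt ft]] := fi_rep f (subgroup1 sG).
exists (t @` setT); split; first exact/finite_image/finite_finset.
  by move=> _ [i _ <-].
move=> g Gg; have Gtg := Gt (f g).
have Mg : M ((t (f g))^-1 * g) by apply: fM => //; apply: ft.
have [l Ll e] := HM _ Mg.
exists (t (f g)), l; split => //.
by rewrite -e -actM; try grp; gsimp.
Qed.

Section Dichotomy.
Variables (K L : set gT).
Hypotheses (sK : is_subgroup K) (sL : is_subgroup L) (KG : K `<=` G) (LG : L `<=` G).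
Hypothesis KL : forall k l, K k -> L l -> k * l = l * k.
Hypothesis fR : fin_index G (prodg K L).

Let KL' k l z : K k -> L l -> act k (act l z) = act l (act k z).
Proof. by move=> Kk Ll; rewrite -!actM; try grp; rewrite KL. Qed.

(** Otherwise every element of [KL] moves the [L]-orbit of [y] to one meeting [V]. Colouring it by a
    point of [V] that is hit shows that the stabilizer of the [L]-orbit has finite index, so that
    [L] is big. *)
Lemma avoid_orbit V : ~ big L -> finite_set V ->
  exists2 k, K k & forall l, L l -> ~ V (act k (act l y)).
Proof.
move=> nL finV; apply: contrapT => no; apply: nL.
have sR := prodg_subgroup sK sL KL.
have RG : prodg K L `<=` G.
  by move=> _ [k [l [/KG Gk /LG Gl ->]]]; apply: subgroupM.
have RL r l : prodg K L r -> L l -> L (r^-1 * l * r).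
  move=> [k [m [Kk Lm ->]]] Ll; have -> : (k * m)^-1 * l * (k * m) = m^-1 * l * m.
    by rewrite invgM -!mulgA (mulgA l) -(KL Kk Ll) -mulgA mulKg.
  by grp.
exists [set g | prodg K L g /\ exists2 l, L l & act g y = act l y].
split; [exact: big_subgroup|by move=> g [/RG]| |by move=> g []].
apply: (fi_trans sG fR).
have [I [c cI]] := finite_colorV finV.
have lP r : exists l, prodg K L r -> L l /\ V (act r (act l y)).
  have [[k [m [Kk Lm ->]]]|nr] := pselect (prodg K L r); last by exists 1.
  apply: contrapT => nol; apply: no; exists k => // l Ll Vl; apply: nol.
  exists (m^-1 * l) => _; split; first by apply: subgroupM => //; apply: subgroupV.
  have Gm := LG Lm; have Gm' := subgroupV sG Gm.
  have Gk := KG Kk; have Gl := LG Ll.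
  have -> : act (k * m) (act (m^-1 * l) y) = act k (act l y).
    by rewrite -!actM; try grp; gsimp.
  exact: Vl.
have [l Hl] := choice lP.
exists I, (fun r => c (act r (act (l r) y))) => r s Rr Rs e.
have [Lr Vr] := Hl _ Rr; have [Ls Vs] := Hl _ Rs.
have {}e := cI _ _ Vr Vs e.
have [Gr Gs Glr Gls] : [/\ G r, G s, G (l r) & G (l s)].
  by split; [apply: RG|apply: RG|apply: LG|apply: LG].
have [Gr' Gs' Gls'] : [/\ G r^-1, G s^-1 & G (l s)^-1] by split; apply: subgroupV.
have Rg : prodg K L (r^-1 * s) by apply: (subgroupM sR) => //; apply: (subgroupV sR).
split => //; set g := r^-1 * s in Rg *; have Gg := RG _ Rg.
have Gg' := subgroupV sG Gg.
exists ((g^-1)^-1 * (l s)^-1 * g^-1 * l r).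
  by apply: (subgroupM sL) => //; apply: RL; grp.
rewrite invgK !actM; try grp.
have -> : act (l r) y = act g (act (l s) y) by rewrite actM // -e actK.
by rewrite !actK.
Qed.

(** Each [L]-orbit in the [KL]-orbit of [y] meets the [K]-orbit of [act l0 y], which lies in [A]. So
    every [L]-orbit avoiding the finite set [V] lies in [A], and finitely many remain. *)
Lemma big_or_almost_all A l0 : fin_gen L -> almost_invariant A -> ~ big L ->
  L l0 -> (forall k, K k -> A (act k (act l0 y))) ->
  finite_set [set x | (exists2 g, G g & x = act g y) /\ ~ A x].
Proof.
move=> fgL cA nL Ll0 Al0; have [V finV HV] := pure_orbits sL LG fgL cA.
(* This provides one [L]-orbit inside [A], to which the exceptional ones are compared. *)
have [k0 Kk0 Vk0] := avoid_orbit nL finV.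
have Ak0 l : L l -> A (act k0 (act l y)).
  move=> Ll; rewrite KL' //; have VL l' : L l' -> ~ V (act l' (act k0 y)).
    by move=> Ll'; rewrite -KL' //; apply: Vk0.
  rewrite HV // -(HV _ VL l0) // -KL' //; exact: Al0.
have finD : finite_set [set x | (exists k l, [/\ K k, L l & x = act k (act l y)])
                                /\ ~ A x].
  pose r v x := [/\ ~ A x, exists2 l, L l & v = act l x &
                 exists k l, [/\ K k, L l & x = act k (act l y)]].
  apply: (finite_rel (r := r) finV) => [v Vv|_ [[k [l [Kk Ll ->]]] nA]]; last first.
    have [[l' Ll' Vl']|no] := pselect (exists2 l', L l' & V (act l' (act k (act l y)))).
      exists (act l' (act k (act l y))) => //; split => //; first by exists l'.
      by exists k, l.
    case: nA; have VL l' : L l' -> ~ V (act l' (act k (act l y))).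
      by move=> Ll' Vl'; apply: no; exists l'.
    have Lc : L (l0 * l^-1) by grp.
    rewrite -(HV _ VL _ Lc) -KL' //.
    have -> : act (l0 * l^-1) (act l y) = act l0 y by rewrite -actM; try grp; gsimp.
    exact: Al0.
  have [[x1 [_ [l1' Ll1' v1] [k1 [l1 [Kk1 Ll1 x1E]]]]]|no] := pselect (exists x, r v x);
    last by apply: (sub_finite_set _ (finite_set0 X)) => x rx; apply: no; exists x.
  (* This element carries the exceptional [L]-orbit onto the one inside [A]; almost invariance
     leaves only finitely many of its points outside [A]. *)
  have Gg : G (k0 * k1^-1) by grp.
  apply: (sub_finite_set _ (almost_invariantC cA Gg)) => x [nA [l' Ll' v2] _].
  split => // nA'; apply: nA'.
  have -> : x = act k1 (act (l'^-1 * l1' * l1) y).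
    have Ll : L (l'^-1 * l1') by grp.
    rewrite actM; try grp; rewrite (KL' _ Kk1 Ll) -x1E actM; try grp.
    by rewrite -v1 v2 actK; try grp.
  have -> z : act (k0 * k1^-1) (act k1 z) = act k0 z.
    by rewrite -actM; try grp; rewrite mulgVK.
  by apply: Ak0; grp.
(* The [G]-orbit is a finite union of translates of the [KL]-orbit. A point outside [A] comes from
   one already outside [A], or from one that [t i] moves out of [A]. *)
have [I [f fI]] := fR; have [t [Gt ft]] := fi_rep f (subgroup1 sG).
have finI : finite_set [set: I] by apply: finite_finset.
pose r i x := ~ A x /\ exists z, x = act (t i) z /\
  (((exists k l, [/\ K k, L l & z = act k (act l y)]) /\ ~ A z) \/
   (A z /\ ~ A (act (t i) z))).
apply: (finite_rel (r := r) finI) => [i _|_ [[g Gg ->] nA]].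

  have finU : finite_set ([set x | (exists k l,
      [/\ K k, L l & x = act k (act l y)]) /\ ~ A x] `|`
      [set z | A z /\ ~ A (act (t i) z)]).
    by rewrite finite_setU; split => //; apply: cA.
  apply: (finite_inv (r := act (t i)) finU) => x [_ [z [-> Hz]]]; by exists z.
have Gtg := Gt (f g); have Gz : G ((t (f g))^-1 * g) by grp.
exists (f g) => //; split => //; exists (act ((t (f g))^-1 * g) y); split.
  by rewrite -actM //; gsimp.
have [Az|nAz] := pselect (A (act ((t (f g))^-1 * g) y)).
  by right; split => //; rewrite -actM //; gsimp.
left; split => //.
have [|k [l [Kk Ll e]]] := fI (t (f g)) g (Gt _) Gg; first exact: ft.
by exists k, l; split => //; rewrite e actM; try grp.
Qed.

End Dichotomy.

(** If neither is big, some [l0] gives a [K]-orbit avoiding [V], hence on one side of [A]; then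
    almost the whole [G]-orbit lies on that side. *)
Theorem dichotomy K L A : is_subgroup K -> is_subgroup L -> K `<=` G -> L `<=` G ->
  (forall k l, K k -> L l -> k * l = l * k) -> fin_index G (prodg K L) ->
  fin_gen K -> fin_gen L -> almost_invariant A ->
  infinite_set [set x | (exists2 g, G g & x = act g y) /\ A x] ->
  infinite_set [set x | (exists2 g, G g & x = act g y) /\ ~ A x] ->
  big K \/ big L.
Proof.
move=> sK sL KG LG KL fR fgK fgL cA iA inA.
apply: contrapT => /not_orP[nK nL].
have LK l k : L l -> K k -> l * k = k * l by move=> Ll Kk; apply/esym/KL.
have fR' : fin_index G (prodg L K).
  apply: fiS fR => // _ [k [l [Kk Ll ->]]]; exists l, k; split => //; exact: KL.
have [V finV HV] := pure_orbits sK KG fgK cA.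
have [l0 Ll0 Vl0] := avoid_orbit sL sK LG KG LK fR' nK finV.
have VK k : K k -> ~ V (act k (act l0 y)).
  move=> Kk; rewrite -actM; try grp; rewrite KL // actM; try grp; exact: Vl0.
have [A0|nA0] := pselect (A (act l0 y)).
  apply: inA; apply: (big_or_almost_all sK sL KG LG KL fR fgL cA nL Ll0) => k Kk.
  exact/(HV _ VK).
have cA' := almost_invariantC cA.
have := big_or_almost_all sK sL KG LG KL fR fgL cA' nL Ll0.
move=> H; apply: iA; apply: sub_finite_set (H _) => [x [gx Ax]|k Kk Ak].
  by split => // nA; apply: nA.
by apply: nA0; apply/(HV _ VK _ Kk).
Qed.

(** * Fibres over the cosets of a normalized subgroup *)

Section Fibres.
Variables (K : set gT).
Hypotheses (sK : is_subgroup K) (KG : K `<=` G).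
Hypothesis nK : forall h k, G h -> act h y = y -> K k -> K (h^-1 * k * h).

Let nK' h k : G h -> act h y = y -> K k -> K (h * k * h^-1).
Proof.
move=> Gh hy Kk; have := nK (subgroupV sG Gh) _ Kk; rewrite invgK; apply.
by rewrite -{1}hy actK.
Qed.

(** When [y] is the coset [H], these are the fibres of [G/H -> G/HK]; by [nK] the stabilizer of [y]
    normalizes [K], so [HK] is a subgroup. *)
Definition fibre (g : gT) : set X := [set act g (act k y) | k in K].

Lemma fibre_eq g g' : G g -> G g' -> fibre g `&` fibre g' !=set0 ->
  fibre g = fibre g'.
Proof.
suff H a b : G a -> G b -> fibre a `&` fibre b !=set0 -> fibre a `<=` fibre b.
  move=> Gg Gg' [x [x1 x2]]; apply/seteqP; split; apply: H => //; by exists x.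
move=> Ga Gb [_ [[k Kk <-] [k' Kk' e]]] _ [k1 Kk1 <-].
have Gk := KG Kk; have Gk' := KG Kk'; have Gk1 := KG Kk1.
(* Because the fibres share a point, [h] fixes [y] and so normalizes [K]. *)
pose h := k'^-1 * b^-1 * a * k.
have Gh : G h by rewrite /h; grp.
have hy : act h y = y by rewrite /h !actM; try grp; rewrite -e !actK.
have Kk2 : K (k' * (h * (k^-1 * k1) * h^-1)).
  by apply: (subgroupM sK) => //; apply: nK' => //; grp.
exists (k' * (h * (k^-1 * k1) * h^-1)) => //.
have -> : act (k' * (h * (k^-1 * k1) * h^-1)) y = act (k' * h * k^-1 * k1) y.
  have hy' : act h^-1 y = y by rewrite -{1}hy actK.
  by rewrite -{2}hy' -actM; try grp; gsimp.
rewrite -!actM; try grp; congr act; rewrite /h; by gsimp.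
Qed.

(** Write [act g y] as [act t (act l y)] with [t] in the finite set [F]. As [K] commutes with [L]
    and is normalized by the stabilizer of [y], the fibre of [g] is the translate by [t] of the
    [K]-orbit of [act l y]. Purity of [K]-orbits for finitely many translates of [A] is then
    enough. *)
Lemma pure_fibres L A : fin_gen K -> (forall k l, K k -> L l -> k * l = l * k) ->
  L `<=` G ->
  (exists F, [/\ finite_set F, F `<=` G & forall g, G g ->
     exists t l, [/\ F t, L l & act g y = act t (act l y)]]) ->
  almost_invariant A ->
  exists2 V, finite_set V & forall g, G g ->
    (forall k, K k -> ~ V (act g (act k y))) ->
    forall k, K k -> (A (act g (act k y)) <-> A (act g y)).
Proof.
move=> fgK KL LG [F [finF FG HF]] cA.
have VP t : exists V, F t -> finite_set V /\
    forall x, (forall k, K k -> ~ V (act k x)) ->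
    forall k, K k -> (A (act t (act k x)) <-> A (act t x)).
  have [Ft|] := pselect (F t); last by exists set0.
  have [V finV HV] := pure_orbits sK KG fgK (almost_invariant_act (FG _ Ft) cA).
  by exists V.
have [V HV] := choice VP.
exists (\bigcup_(t in F) (act t @` V t)).
  by apply: bigcup_finite => // t /HV[fV _]; apply: finite_image.
move=> g Gg Vg k Kk; have [t [l [Ft Ll e]]] := HF g Gg.
have Gt := FG _ Ft; have Gl := LG _ Ll; have Gk := KG Kk.
pose h := (t * l)^-1 * g; have Gh : G h by rewrite /h; grp.
have hy : act h y = y.
  by rewrite /h actM; try grp; rewrite e -!actM; try grp; gsimp; rewrite act1.
have gE k' : K k' -> act g (act k' y) = act t (act (h * k' * h^-1) (act l y)).
  move=> Kk'; have Kc := nK' Gh hy Kk'; have Gk' := KG Kk'.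
  have hy' : act h^-1 y = y by rewrite -{1}hy actK.
  rewrite -[act (h * _ * _) _]actM; try grp; rewrite (KL _ _ Kc Ll) -{1}hy'.
  rewrite -!actM; try grp; congr act; rewrite /h; by gsimp.
rewrite gE // e; apply: (HV t Ft).2 => [k' Kk' Vk'|]; last exact: nK'.
apply: (Vg (h^-1 * k' * h)); first exact: nK.
exists t => //; exists (act k' (act l y)) => //; rewrite gE; last exact: nK.
by congr (act _ (act _ _)); gsimp.
Qed.

(** If no fibre lies in [A], those avoiding [V] miss [A]. Each of the finitely many others is moved
    by [g0 * g1^-1] onto a fibre missing [A], so it has finitely many points in [A], and [A] is
    finite on the orbit. *)
Lemma pure_fibre_in A V : almost_invariant A ->
  (forall g, G g -> (forall k, K k -> ~ V (act g (act k y))) ->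
    forall k, K k -> (A (act g (act k y)) <-> A (act g y))) -> finite_set V ->
  (exists2 g, G g & forall k, K k -> ~ V (act g (act k y))) ->
  infinite_set [set x | (exists2 g, G g & x = act g y) /\ A x] ->
  exists2 g, G g & forall k, K k -> A (act g (act k y)).
Proof.
move=> cA HV finV [g0 Gg0 Vg0] iA; apply: contrapT => no; apply: iA.
have nA0 g : G g -> (forall k, K k -> ~ V (act g (act k y))) ->
    forall k, K k -> ~ A (act g (act k y)).
  move=> Gg Vg k Kk Ak; apply: no; exists g => // k' Kk'.
  by rewrite HV // -(HV g Gg Vg k).
pose r v x := exists g k, [/\ G g, K k, x = act g y, v = act g (act k y) & A x].
apply: (finite_rel (r := r) finV) => [v Vv|_ [[g Gg ->] Ag]]; last first.
  have [[k Kk Vk]|noV] := pselect (exists2 k, K k & V (act g (act k y))).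
    by exists (act g (act k y)) => //; exists g, k.
  exfalso; apply: (nA0 g Gg _ 1) => //; [|exact: subgroup1|by rewrite act1].
  by move=> k Kk Vk; apply: noV; exists k.
have [[x1 [g1 [k1 [Gg1 Kk1 x1E v1 _]]]]|nor] := pselect (exists x, r v x); last first.
  by apply: (sub_finite_set _ (finite_set0 X)) => x rx; apply: nor; exists x.
have Gc : G (g0 * g1^-1) by grp.
apply: (sub_finite_set _ (cA _ Gc)) => x [g [k [Gg Kk xE vE Ax]]]; split => //.
have : fibre g1 x.
  rewrite (@fibre_eq g1 g) //; first by exists 1; [apply: subgroup1|rewrite act1 xE].
  by exists v; split; [exists k1|exists k].
move=> [k2 Kk2 <-]; have -> z : act (g0 * g1^-1) (act g1 z) = act g0 z.
  by rewrite -actM; try grp; rewrite mulgVK.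
exact: nA0.
Qed.

End Fibres.

End Actions.

(** * Moving a fibre across the boundary of a commensurated set *)

Section Chain.
Local Open Scope group_scope.
Variables (gT : groupType) (G S : set gT) (X : choiceType) (act : gT -> X -> X).
Hypotheses (sG : is_subgroup G) (actP : is_action G act).
Hypotheses (SV : forall s, S s -> S s^-1) (GS : generated S = G).
Implicit Types (A : set X).

Lemma gens_sub : S `<=` G. Proof. by rewrite -GS; apply: generated_gen. Qed.

(** Induction on words in [S]. The statement is strengthened to left multiplication by [g] and
    [g^-1], so that the elements satisfying it form a subgroup. *)
Lemma gen_ind (P : gT -> Prop) : P 1 -> (forall s g, S s -> G g -> P g -> P (s * g)) ->
  forall g, G g -> P g.
Proof.
move=> P1 PS; have SG := gens_sub.
suff H g : G g -> forall h, G h -> P h -> P (g * h) /\ P (g^-1 * h).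
  by move=> g Gg; have [] := H g Gg 1 (subgroup1 sG) P1; rewrite mulg1.
rewrite -{1}GS => Sg; suff : [set g | G g /\
    forall h, G h -> P h -> P (g * h) /\ P (g^-1 * h)] g by case.
move: g Sg; apply: generated_sub => [|s Ss]; last first.
  by split => [|h Gh Ph]; [exact: SG|split; apply: PS => //; apply: SV].
split => [|a b [Ga Ha] [Gb Hb]|a [Ga Ha]]; split; try grp.
- by move=> h Gh Ph; rewrite invg1 !mul1g.
- move=> h Gh Ph; split.
    by rewrite -mulgA; apply: (Ha _ _ _).1; [grp|apply: (Hb _ _ _).1].
  rewrite invgM -mulgA; apply: (Hb _ _ _).2; [grp|exact: (Ha _ _ _).2].
- by move=> h Gh Ph; rewrite invgK; have [] := Ha h Gh Ph.
Qed.

Lemma almost_invariant_gen A :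
  (forall s, S s -> finite_set [set x | A x /\ ~ A (act s x)]) ->
  almost_invariant G act A.
Proof.
move=> finA; apply: gen_ind => [|s g Ss Gg fing].
  by apply: sub_finite_set (finite_set0 X) => x /=; rewrite (act1 actP) => -[].
have Gs := gens_sub Ss.
have finU : finite_set ([set x | A x /\ ~ A (act g x)] `|`
                        (act g^-1 @` [set x | A x /\ ~ A (act s x)])).
  by rewrite finite_setU; split => //; apply: finite_image; apply: finA.
apply: sub_finite_set finU => x [Ax]; rewrite (actM actP) // => nA.
have [Agx|nAgx] := pselect (A (act g x)); last by left.
by right; exists (act g x) => //; rewrite (actK sG).
Qed.

Variables (y : X) (K : set gT).
Hypotheses (sK : is_subgroup K) (KG : K `<=` G).
Hypothesis nK : forall h k, G h -> act h y = y -> K k -> K (h^-1 * k * h).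

(** Adjacency in the Schreier graph whose vertices are the fibres, made boolean for use with
    [path]. *)
Let e := fun P Q : set X => `[< exists2 s, S s & Q = act s @` P >].

Lemma fibre_act s g : G s -> G g ->
  act s @` fibre act y K g = fibre act y K (s * g).
Proof.
move=> Gs Gg; apply/seteqP; split => [_ [_ [k Kk <-] <-]|_ [k Kk <-]].
  by exists k => //; rewrite (actM actP).
by exists (act g (act k y)); [exists k|rewrite (actM actP)].
Qed.

Lemma fibre_path g : G g -> forall g', G g' -> exists p,
  path e (fibre act y K g') p /\ last (fibre act y K g') p = fibre act y K (g * g').
Proof.
move: g; apply: gen_ind => [|s g Ss Gg IH] g' Gg'; first by exists [::]; rewrite mul1g.
have [p [ep lp]] := IH g' Gg'; exists (rcons p (fibre act y K (s * (g * g')))).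
rewrite last_rcons rcons_path ep lp mulgA; split => //=; apply/asboolP.
exists s => //; rewrite fibre_act ?mulgA //; first exact: gens_sub.
exact: subgroupM.
Qed.

(* The fibres on a simple path are disjoint, so the points from which the moved
   copies of [zs] enter [A] are distinct. *)
Lemma fibre_chain A (p : seq (set X)) (P : set X) (zs : seq X) :
  (exists2 g, G g & P = fibre act y K g) -> path e P p -> uniq (P :: p) ->
  uniq zs -> (forall z, z \in zs -> P z /\ ~ A z) -> last P p `<=` A ->
  exists ws, [/\ uniq ws, size ws = size zs & forall w, w \in ws ->
    (exists2 s, S s & ~ A w /\ A (act s w)) /\
    exists Q, [/\ Q \in P :: p, exists2 g, G g & Q = fibre act y K g & Q w]].
Proof.
elim: p P zs => [|Q p IH] P zs [g Gg PE].
  case: zs => [|z zs] _ _ _ Pzs PA; first by exists [::].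
  by have [Pz []] := Pzs z (mem_head _ _); apply: PA.
move=> /= /andP[/asboolP[s Ss QE] pp] /andP[PQp uQp] uz Pz lA.
(* Points entering [A] at this step are recorded; the others move on to the next fibre and are left
   to the induction. *)
have Gs := gens_sub Ss; pose a := [pred z | `[< A (act s z) >]].
have sI z z' : act s z = act s z' -> z = z'.
  by move=> /(congr1 (act s^-1)); rewrite !(actK sG actP).
have [|||] := IH Q (map (act s) (filter (predC a) zs)) _ pp uQp _ _ lA.
- by exists (s * g); [apply: subgroupM|rewrite QE PE fibre_act].
- by rewrite map_inj_uniq // filter_uniq.
- move=> w /mapP[z]; rewrite mem_filter /= => /andP[/asboolP nA zzs] ->.
  by split => //; rewrite QE; exists z => //; have [] := Pz z zzs.
move=> ws [uw sw Hw]; exists (filter a zs ++ ws); split.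
- rewrite cat_uniq filter_uniq //= uw andbT; apply/hasPn => w wws.
  have [_ [R [RQp [h Gh RE] Rw]]] := Hw w wws.
  rewrite mem_filter; apply/negP => /andP[_ wzs]; have [Pw _] := Pz w wzs.
  have PR : P = R.
    by rewrite PE RE; apply: (fibre_eq sG actP sK KG nK) => //; exists w; rewrite -PE -RE.
  by move: PQp; rewrite PR RQp.
- by rewrite size_cat sw size_map !size_filter count_predC.
move=> w; rewrite mem_cat => /orP[|wws]; last first.
  have [sA [R [RQp RE Rw]]] := Hw w wws.
  by split => //; exists R; split => //; rewrite inE RQp orbT.
rewrite mem_filter => /andP[/asboolP Aw wzs]; have [Pw nAw] := Pz w wzs.
split; first by exists s.
by exists P; split => //; [rewrite mem_head|exists g].
Qed.

(** Move [zs] to the fibre of [g'], outside [A], and along a simple path to the fibre of [g], inside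
    [A]. The points enter [A] from distinct boundary points, so the bound is independent of [K]. *)
Lemma fibre_bound A g g' : G g -> G g' -> (forall k, K k -> A (act g (act k y))) ->
  (forall k, K k -> ~ A (act g' (act k y))) ->
  forall ws0 : seq X,
    [set x | exists2 s, S s & ~ A x /\ A (act s x)] `<=` [set` ws0] ->
  forall zs : seq X, uniq zs -> (forall z, z \in zs -> exists2 k, K k & z = act k y) ->
  (size zs <= size ws0)%N.
Proof.
move=> Gg Gg' Ag nAg' ws0 HW zs uz Hz.
have Gd : G (g * g'^-1) by grp.
have [p [pp lp]] := fibre_path Gd Gg'.
have := lp; case/shortenP: pp => p' pp' up' _; rewrite mulgVK => lp'.
have [||||] := @fibre_chain A p' _ (map (act g') zs) _ pp' up'.
- by exists g'.
- rewrite map_inj_uniq // => a b /(congr1 (act g'^-1)).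
  by rewrite !(actK sG actP).
- move=> z /mapP[x /Hz[k Kk ->] ->]; split; last exact: nAg'.
  by exists k.
- by rewrite lp' => _ [k Kk <-]; apply: Ag.
move=> ws [uw sw Hw]; rewrite -(size_map (act g')) -sw.
by apply: uniq_leq_size => // w wws; apply: HW; have [] := Hw w wws.
Qed.

End Chain.

(** * Ends of Schreier graphs *)

Section SchreierEnds.
Local Open Scope group_scope.
Variables (gT : groupType) (G S H : set gT).
Hypotheses (sG : is_subgroup G) (sH : is_subgroup H) (HG : H `<=` G).
Hypotheses (finS : finite_set S) (SV : forall s, S s -> S s^-1) (GS : generated S = G).
Implicit Types (A Sig : set (set gT)).
Notation Gam := (schreier G S H).

Lemma lcoset_action (M : set gT) : is_action M (@lcoset gT).
Proof. by split => [C|g h C _ _]; [apply: lcoset1|apply: lcosetM]. Qed.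

Let lcK g (C : set gT) : lcoset g^-1 (lcoset g C) = C.
Proof. by rewrite -lcosetM mulVg lcoset1. Qed.

Let lcVK g (C : set gT) : lcoset g (lcoset g^-1 C) = C.
Proof. by rewrite -lcosetM mulgV lcoset1. Qed.

Lemma lcosets_act g C : G g -> lcosets G H C -> lcosets G H (lcoset g C).
Proof.
by move=> Gg [h Gh <-]; exists (g * h); [apply: subgroupM|rewrite lcosetM].
Qed.

Lemma clos_rst_iff (X : Type) (R : X -> X -> Prop) (Q : X -> Prop) x y :
  (forall a b, R a b -> (Q a <-> Q b)) -> clos_refl_sym_trans _ R x y -> (Q x <-> Q y).
Proof.
by move=> HQ; elim=> // [a b _ ->|a b c _ -> _ ->].
Qed.

Lemma component_sub Sig x : (lcosets G H `\` Sig) x ->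
  component_off (Gam := Gam) Sig x `<=` lcosets G H `\` Sig.
Proof.
move=> Xx z xz; apply/(@clos_rst_iff _ _ (lcosets G H `\` Sig) x z _ xz) => //.
by move=> a b [].
Qed.

Lemma component_eq Sig x z : component_off (Gam := Gam) Sig x z ->
  component_off (Gam := Gam) Sig x = component_off (Gam := Gam) Sig z.
Proof.
move=> xz; apply/seteqP; split => w xw; apply: rst_trans xw => //.
exact: rst_sym.
Qed.

(** A generator can move a vertex out of its component only into [Sig]. *)
Lemma component_almost_invariant Sig x : finite_set Sig -> (lcosets G H `\` Sig) x ->
  almost_invariant G (@lcoset gT) (component_off (Gam := Gam) Sig x).
Proof.
move=> finSig Xx; apply: (almost_invariant_gen sG (lcoset_action G) SV GS) => s Ss.
apply: (finite_inv (r := lcoset s^-1) finSig) => z [xz nxz].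
have Gs := gens_sub GS Ss; have [Xz nz] := component_sub Xx xz.
exists (lcoset s z); last exact: lcK.
apply: contrapT => nsz; apply: nxz; apply: rst_trans xz _; apply: rst_step.
split; [split => //|split => //|by exists s].
exact: lcosets_act.
Qed.

(** With the converse below, this replaces counting components by families of disjoint infinite
    commensurated sets, which can be carried from one coset space to another. *)
Lemma end_counts_disjoint n : end_counts Gam n ->
  exists A : nat -> set (set gT),
    (forall i, (i < n)%N -> [/\ A i `<=` lcosets G H, infinite_set (A i) &
                               almost_invariant G (@lcoset gT) (A i)]) /\
    (forall i j, (i < n)%N -> (j < n)%N -> A i `&` A j !=set0 -> i = j).
Proof.
move=> [Sig [SX finSig /pcard_leP]]; rewrite injfunPex => -[f fS fI]; exists f.
have fP i : (i < n)%N -> infinite_components (Gam := Gam) Sig (f i) by apply: fS.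
split => [i /fP[[x Xx ->] inf]|i j ni nj [z [zi zj]]].
  split => //; first by move=> z /(component_sub Xx)[].
  exact: component_almost_invariant.
have [[x Xx fin_index] _] := fP i ni; have [[x' Xx' fj] _] := fP j nj.
apply: fI; rewrite ?inE //.
rewrite fin_index in zi *; rewrite fj in zj *.
exact: etrans (component_eq zi) (esym (component_eq zj)).
Qed.

(** Removing the boundaries of all [A i] leaves components that do not cross them. There are
    finitely many components, so each infinite [A i] contains an infinite one. *)
Lemma disjoint_end_counts n (A : nat -> set (set gT)) :
  (forall i, (i < n)%N -> [/\ A i `<=` lcosets G H, infinite_set (A i) &
                             almost_invariant G (@lcoset gT) (A i)]) ->
  (forall i j, (i < n)%N -> (j < n)%N -> A i `&` A j !=set0 -> i = j) ->
  end_counts Gam n.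
Proof.
move=> HA dA; have SG := gens_sub GS.
(* The base coset [H] is included so that a path from it to any other vertex starts in [Sig]. *)
pose Sig : set (set gT) := [set H] `|` \bigcup_(i in `I_n) \bigcup_(s in S)
  [set x | A i x /\ ~ A i (lcoset s x)].
have finSig : finite_set Sig.
  rewrite /Sig finite_setU; split; first exact: finite_set1.
  apply: bigcup_finite => [|i ni]; first exact: finite_II.
  by apply: bigcup_finite => // s /SG Gs; have [_ _] := HA i ni; apply.
have XH : lcosets G H H by exists 1; [apply: subgroup1|apply: lcoset1].
have SX : Sig `<=` lcosets G H.
  by move=> x [->//|[i ni [s _ [Ax _]]]]; have [AX _ _] := HA i ni; apply: AX.
pose comp x := component_off (Gam := Gam) Sig x.
have edgeA i a b : (i < n)%N -> edge_off (Gam := Gam) Sig a b -> A i a <-> A i b.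
  move=> ni [[Xa Sa] [Xb Sb] [s Ss bE]]; split => [Aa|Ab]; apply: contrapT => nA.
    by apply: Sa; right; exists i => //; exists s => //=; rewrite -bE.
  apply: Sb; right; exists i => //; exists s^-1; first exact: SV.
  by split => //=; rewrite bE lcK.
have compA i x : (i < n)%N -> A i x -> comp x `<=` A i.
  move=> ni Ax z xz; apply/(@clos_rst_iff _ _ (A i) x z _ xz) => //.
  by move=> a b; apply: edgeA.
(* [W] consists of the neighbours of [Sig]. By [hit] every component meets this finite set. *)
pose W := \bigcup_(s in S) (lcoset s^-1 @` Sig).
have finW : finite_set W by apply: bigcup_finite => // s _; apply: finite_image.
have hit x : (lcosets G H `\` Sig) x -> exists2 w, W w & comp w = comp x.
  suff Hr : forall h, G h -> forall z, (lcosets G H `\` Sig) z -> Sig (lcoset h^-1 z) ->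
      exists2 w, W w & comp w = comp z.
    move=> [[g Gg <-] nS]; apply: (Hr g Gg); first by split => //; exists g.
    by rewrite lcK; left.
  apply: (gen_ind sG SV GS) => [z [_ nz]|s h Ss Gh IH z [Xz nz]].
    by rewrite invg1 lcoset1 => /nz.
  rewrite invgM lcosetM => Sz; have Gs := SG _ Ss.
  have [Ssz|nSsz] := pselect (Sig (lcoset s^-1 z)).
    exists z => //; exists s^-1; first exact: SV.
    by exists (lcoset s^-1 z) => //; rewrite invgK lcVK.
  have Xsz : (lcosets G H `\` Sig) (lcoset s^-1 z).
    by split => //; apply: lcosets_act => //; apply: subgroupV.
  have [w Ww wE] := IH _ Xsz Sz; exists w => //; rewrite wE.
  apply: component_eq; apply: rst_step; split => //; exists s => //.

have big i : exists x, (i < n)%N -> [/\ A i x, (lcosets G H `\` Sig) x & infinite_set (comp x)].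
  have [ni|] := pselect (i < n)%N; last by exists H.
  have [AX infA cA] := HA i ni.
  have [x Hx] : exists x, [/\ A i x, (lcosets G H `\` Sig) x & infinite_set (comp x)].
    apply: contrapT => no; apply: infA.
    have finU : finite_set (Sig `|` \bigcup_(w in W)
        [set x | [/\ comp w x, A i x & (lcosets G H `\` Sig) x]]).
      rewrite finite_setU; split => //; apply: bigcup_finite => // w Ww.
      apply: contrapT => inf; apply: no.
      have [x [wx Ax Xx]] := infinite_setN0 inf.
      exists x; split => //; rewrite /comp -(component_eq wx).
      by apply: sub_infinite_set inf => z [].
    apply: sub_finite_set finU => x Ax.
    have [?|nS] := pselect (Sig x); [by left|right].
    have Xx : (lcosets G H `\` Sig) x by split => //; apply: AX.
    have [w Ww wE] := hit x Xx; exists w => //; split => //.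
    by rewrite wE; apply: rst_refl.
  by exists x.
have [x Hx] := choice big.
exists Sig; split => //; apply/pcard_leP; rewrite injfunPex.
exists (comp \o x) => [i ni|i j] /=.
  by have [Ax Xx inf] := Hx i ni; split => //; exists (x i).
rewrite !inE /= => ni nj e; apply: dA => //; exists (x i).
have [Ai Xi _] := Hx i ni; have [Aj Xj _] := Hx j nj; split => //.
apply: (compA j _ nj Aj); rewrite -e; apply: rst_refl.
Qed.

Lemma end_counts_le m n : (m <= n)%N -> end_counts Gam n -> end_counts Gam m.
Proof.
move=> mn [Sig [SX fS nI]]; exists Sig; split => //.
by apply: card_le_trans nI; rewrite card_le_II.
Qed.

End SchreierEnds.

(** * The number of ends as an extended natural number *)

Section NumEnds.

(** If the supremum were not attained, its predecessor would be an upper bound too. *)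
Lemma supremum_nat_max (A : set nat) : has_ubound A -> A !=set0 ->
  A (supremum 0%N A) /\ forall n, A n -> (n <= supremum 0%N A)%N.
Proof.
move=> ubA [a Aa]; have ne := nat_supremums_neq0 ubA.
have ub n : A n -> (n <= supremum 0%N A)%N by move=> An; exact: (ge_supremum_Nmem 0%N ne An).
split => //; apply: contrapT => nA.
have A0 : A != set0 by apply/set0P; exists a.
have : lbound (ubound A) (supremum 0%N A).
  by rewrite /supremum (negbTE A0); case: xgetP => [z -> []|/(_ _) no] //;
    have [z z1] := ne; case: (no z).
move=> /(_ (supremum 0%N A).-1).
have lt n : A n -> (n < supremum 0%N A)%N.
  by move=> An; rewrite ltn_neqAle ub // andbT; apply/eqP => e; apply: nA; rewrite -e.
have s0 := leq_ltn_trans (leq0n a) (lt a Aa).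
have H : ubound A (supremum 0%N A).-1.
  by move=> n /lt; rewrite -{1}(prednK s0).
by move=> /(_ H); rewrite -{1}(prednK s0) => /(leq_trans (ltnSn _)); rewrite ltnn.
Qed.

Variables Gam Gam' : graph.

Lemma end_counts0 : end_counts Gam 0.
Proof.
exists set0; split; [by []|exact: finite_set0|].
by apply/pcard_leP; rewrite injfunPex; exists (fun=> set0) => [i|i j]; rewrite ?inE.
Qed.

Lemma num_ends_gt1 : ~~ enat_le (num_ends Gam) (Some 1%N) ->
  exists2 n, (1 < n)%N & end_counts Gam n.
Proof.
rewrite /num_ends; case: ifPn => [/asboolP ub|/asboolPn nub] /=.
  rewrite -ltnNge => lt1; exists (supremum 0%N (end_counts Gam)) => //.
  by apply: (supremum_nat_max ub _).1; exists 0%N; apply: end_counts0.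
move=> _; apply: contrapT => no; apply: nub; exists 1%N => n En.
suff : (n <= 1)%N by [].
by rewrite leqNgt; apply/negP => ?; apply: no; exists n.
Qed.

Lemma num_ends_gt1V n : (1 < n)%N -> end_counts Gam n ->
  ~~ enat_le (num_ends Gam) (Some 1%N).
Proof.
move=> n1 En; rewrite /num_ends; case: ifPn => [/asboolP ub|//] /=.
rewrite -ltnNge; apply: leq_trans n1 _.
by apply: (supremum_nat_max ub _).2 => //; exists n.
Qed.

Lemma num_ends_le : end_counts Gam `<=` end_counts Gam' ->
  enat_le (num_ends Gam) (num_ends Gam').
Proof.
move=> sub; rewrite /num_ends; case: ifPn => [/asboolP ub|/asboolPn nub];
  case: ifPn => [/asboolP ub'|/asboolPn nub'] //=.
  apply: (supremum_nat_max ub' _).2; first by exists 0%N; apply/sub/end_counts0.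
  by apply/sub/(supremum_nat_max ub _).1; exists 0%N; apply: end_counts0.
by case: nub; case: ub' => m Hm; exists m => n /sub/Hm.
Qed.

Lemma one_endedP : end_counts Gam 1 -> (forall n, end_counts Gam n -> (n <= 1)%N) ->
  one_ended Gam.
Proof.
move=> E1 le1; rewrite /one_ended /num_ends.
have ub : has_ubound (end_counts Gam) by exists 1%N => n /le1.
case: ifPn => [_|/asboolPn //]; congr Some.
have [Es sE] := supremum_nat_max ub (ex_intro _ _ E1).
by apply/eqP; rewrite eqn_leq le1 // sE.
Qed.

End NumEnds.

(** * Rooted trees *)

Section TreeGeometry.
Variable T : rooted_tree.
Implicit Types (u v w : T) (g : tree_aut T) (xi : nat -> T).

Lemma dist_path v w : has_path v w (dist v w).
Proof. by rewrite /dist; case: ex_minnP => n /asboolP. Qed.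

Lemma dist_le v w n : has_path v w n -> (dist v w <= n)%N.
Proof. by move=> vw; rewrite /dist; case: ex_minnP => m _; apply; apply/asboolP. Qed.

Lemma has_path_cat u v w m n : has_path u v m -> has_path v w n ->
  has_path u w (m + n).
Proof.
move=> [p [pp <- <-]] [q [pq <- <-]]; exists (p ++ q).
by rewrite cat_path last_cat size_cat pp pq.
Qed.

Lemma has_path1 v w : adj v w -> has_path v w 1.
Proof. by move=> vw; exists [:: w]; rewrite /= vw. Qed.

Lemma dist_triangle u v w : (dist u w <= dist u v + dist v w)%N.
Proof. exact: dist_le (has_path_cat (dist_path _ _) (dist_path _ _)). Qed.

Lemma level0 v : level v = 0%N -> v = Defs.root T.
Proof.
rewrite /level => e; have := dist_path (Defs.root T) v; rewrite e.
by move=> [p [_ <- /size0nil ->]].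
Qed.

Lemma level_root : level (Defs.root T) = 0%N.
Proof. by apply/eqP; rewrite -leqn0; apply: dist_le; exists [::]. Qed.

Lemma level_adj v w : adj v w -> (level w <= (level v).+1)%N.
Proof.
move=> vw; rewrite -addn1; apply: leq_trans (dist_triangle _ v _) _.
by rewrite leq_add2l; apply/dist_le/has_path1.
Qed.

Lemma parent_ex v : exists u, level u = (level v).-1 /\ ((0 < level v)%N -> adj u v).
Proof.
have [p [pp pv sp]] := dist_path (Defs.root T) v.
case: (lastP p) pp pv sp => [|q x] /=.
  by move=> _ <- _; exists (Defs.root T); rewrite level_root.
rewrite rcons_path last_rcons size_rcons => /andP[pq ux] xv; rewrite -/(level v).
rewrite -xv in ux *; move=> sq; exists (last (Defs.root T) q); split => //.
apply/eqP; rewrite eqn_leq -sq /=; apply/andP; split.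
  by apply: dist_le; exists q.
by have := level_adj ux; rewrite -sq ltnS.
Qed.

(** The root is its own parent, since the parent has level [(level v).-1]. *)
Definition parent v : T := sval (cid (parent_ex v)).

Lemma level_parent v : level (parent v) = (level v).-1.
Proof. by rewrite /parent; case: cid => u []. Qed.

Lemma adj_parent v : (0 < level v)%N -> adj (parent v) v.
Proof. by rewrite /parent; case: cid => u []. Qed.

(* Joining the two upward geodesics where they first meet. *)
Lemma lower_path k a b : a != b -> level a = k -> level b = k -> exists p : seq T,
  [/\ path (@adj T) a (rcons p b), uniq (a :: rcons p b) & all (fun c => level c < k)%N p].
Proof.
elim: k a b => [|k IH] a b ab la lb.
  by move: ab; rewrite (level0 la) (level0 lb) eqxx.
have pa := adj_parent (v := a); have pb := adj_parent (v := b).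
rewrite la in pa; rewrite lb in pb.
have [e|ne] := eqVneq (parent a) (parent b).
  exists [:: parent b]; rewrite /= adj_sym -{1}e pa // pb // level_parent lb /= ltnSn.
  split => //; rewrite !inE (negbTE ab) orbF andbT.
  apply/andP; split; apply/eqP => e'.
    by have := level_parent b; rewrite -e' la lb /= => /eqP; rewrite eqn_leq ltnn.
  by have := level_parent b; rewrite e' lb /= => /eqP; rewrite eqn_leq ltnn.
have [||p [pp up lp]] := IH _ _ ne; rewrite ?level_parent ?la ?lb //.
exists (parent a :: rcons p (parent b)).
have lq : all (fun c => level c < k.+1)%N (parent a :: rcons p (parent b)).
  rewrite /= all_rcons !level_parent la lb !ltnSn /=.
  by apply: sub_all lp => c /ltnW; rewrite -ltnS.
have nq c : level c = k.+1 -> c \notin parent a :: rcons p (parent b).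
  by move=> lc; apply/negP => /(allP lq); rewrite lc ltnn.
split; last exact: lq.
  by rewrite /= adj_sym pa //= rcons_path pp last_rcons pb.
by rewrite cons_uniq mem_rcons rcons_uniq up in_cons negb_or ab !nq.
Qed.

(** Two different parents of [v], joined by a path through vertices closer to the root, would close
    up through [v] to a cycle with more than two vertices. *)
Lemma parent_unique u v : adj u v -> level v = (level u).+1 -> parent v = u.
Proof.
move=> uv lv; apply: contrapT => /eqP ne.
have pv : adj (parent v) v by apply: adj_parent; rewrite lv.
have [||p [pp up lp]] := lower_path (k := level u) ne; rewrite ?level_parent ?lv //.
have := @adj_acyclic T [:: v, parent v & rcons p u].
suff c : ucycle (@adj T) [:: v, parent v & rcons p u].
  by move=> /(_ c); rewrite /= size_rcons.
rewrite /ucycle /cycle.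
have -> : path (@adj T) v (rcons (parent v :: rcons p u) v).
  by rewrite rcons_path /= adj_sym pv pp last_rcons uv.
rewrite cons_uniq up andbT inE mem_rcons inE !negb_or /=.
apply/and3P; split; [apply/eqP => e|apply/eqP => e|apply/negP => /(allP lp)].
- by have := level_parent v; rewrite -e lv => /eqP; rewrite eqn_leq ltnn.
- by move: lv; rewrite e => /eqP; rewrite eqn_leq ltnn andbF.
- by rewrite lv ltnNge leqnSn.
Qed.

Lemma level_iter_parent n v : level (iter n parent v) = (level v - n)%N.
Proof. by elim: n => [|n /= IH]; rewrite ?subn0 // level_parent IH subnS. Qed.

(** On a geodesic whose length is the difference of levels, each step must go down by exactly one
    level, so each vertex is the parent of the next. *)
Lemma subtreeP v w : subtree v w <->
  (level v <= level w)%N /\ iter (level w - level v) parent w = v.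
Proof.
rewrite /subtree /=; split => [lw|[le e]].
  split; first by rewrite lw leq_addr.
  have [p [pp pw sp]] := dist_path v w; move: lw; rewrite -sp => lw.
  rewrite lw addKn; have up (q : seq T) x : path (@adj T) x q ->
      (level (last x q) <= level x + size q)%N.
    elim: q x => [|y q IH] x /=; first by rewrite addn0.
    move=> /andP[xy /IH] /leq_trans; apply; rewrite addnS -addSn leq_add2r.
    exact: level_adj.
  elim/last_ind: p w pp pw {sp} lw => [|p x IH] w /= => [_ <- //|].
  rewrite last_rcons rcons_path size_rcons => /andP[pp ux] xw; rewrite -{}xw => lx.
  have lu : level (last v p) = (level v + size p)%N.
    by apply/eqP; rewrite eqn_leq up //= -ltnS -addnS -lx level_adj.
  rewrite -[in LHS]/((size p).+1) iterSr (@parent_unique (last v p)) ?IH //.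
  by rewrite lx lu addnS.
apply/eqP; rewrite eqn_leq dist_triangle /=.
rewrite -(subnKC le) leq_add2l; apply: dist_le.
move: (leqnn (level w - level v)) e.
suff H n x : (n <= level x)%N -> has_path (iter n parent x) x n.
  by move=> _ e; rewrite -{1}e; apply: H; apply: leq_subr.
elim: n => [|n IH] nx; first by exists [::].
rewrite -add1n; apply: has_path_cat _ (IH (ltnW nx)).
by apply/has_path1/adj_parent; rewrite level_iter_parent subn_gt0.
Qed.

Lemma subtree_refl v : subtree v v.
Proof. by apply/subtreeP; rewrite subnn. Qed.

Lemma subtree_level v w : subtree v w -> (level v <= level w)%N.
Proof. by move=> /subtreeP[]. Qed.

Lemma subtree_trans u v w : subtree u v -> subtree v w -> subtree u w.
Proof.
move=> /subtreeP[uv <-] /subtreeP[vw e]; apply/subtreeP.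
rewrite level_iter_parent subKn //; split; first exact: leq_trans vw.
by rewrite -[in RHS]e -iterD level_iter_parent subKn // addnC addnBA // subnK.
Qed.

Lemma subtree_anc u v w : subtree u w -> subtree v w -> (level u <= level v)%N ->
  subtree u v.
Proof.
move=> /subtreeP[uw eu] /subtreeP[vw ev] uv; apply/subtreeP; split => //.
by rewrite -[RHS]eu -[in LHS]ev -iterD level_iter_parent subKn // addnC addnBA // subnK.
Qed.

Lemma subtree_eq v w : subtree v w -> level v = level w -> v = w.
Proof. by move=> /subtreeP[_ e] l; rewrite -e l subnn. Qed.

Lemma subtree_inj u v w : subtree u w -> subtree v w -> level u = level v -> u = v.
Proof.
by move=> uw vw l; apply: subtree_eq => //; apply: subtree_anc vw _ => //; rewrite l.
Qed.

Lemma anc_ex m w : (m <= level w)%N -> exists2 v, level v = m & subtree v w.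
Proof.
move=> mw; exists (iter (level w - m) parent w); first by rewrite level_iter_parent subKn.
by apply/subtreeP; rewrite level_iter_parent subKn // leq_subr.
Qed.

Lemma aut_dist g v w : dist (g v) (g w) = dist v w.
Proof.
have H (f : tree_aut T) x y : (dist (f x) (f y) <= dist x y)%N.
  have [p [pp <- <-]] := dist_path x y; apply: dist_le; exists (map f p).
  rewrite last_map size_map; split => //; rewrite (map_path (e' := @adj T) (b := pred0)) //.
    by move=> a b _; rewrite aut_adj.
  exact/hasPn.
apply/eqP; rewrite eqn_leq H /=.
by have [f [fK _]] := aut_inv_ex g; rewrite -{1}(fK v) -{1}(fK w).
Qed.

Lemma aut_level g v : level (g v) = level v.
Proof. by rewrite /level -{1}(aut_root g) aut_dist. Qed.

Lemma aut_subtree g v w : subtree (g v) (g w) <-> subtree v w.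
Proof. by rewrite /subtree /= !aut_level aut_dist. Qed.

Lemma boundaryP xi : boundary T xi <-> forall n, level (xi n) = n /\ parent (xi n.+1) = xi n.
Proof.
split => [[x0 dx] n|H].
  have lx m : level (xi m) = m by rewrite /level -x0 dx // subn0.
  split => //; apply: parent_unique; last by rewrite !lx.
  have [p [pp pl]] := dist_path (xi n) (xi n.+1).
  rewrite dx // subSnn; case: p pp pl => [|y []] //=.
  by rewrite andbT => + <-.
split; first by apply: level0; have [] := H 0%N.
move=> m n mn; have : subtree (xi m) (xi n).
  apply/subtreeP; rewrite (H m).1 (H n).1; split => //.
  move: mn => /subnK; move: (n - m)%N => k <-; elim: k => [|k IH] //.
  by rewrite iterSr addSn (H _).2.
by rewrite /subtree /= (H m).1 (H n).1 => {2}->; rewrite addKn.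
Qed.

Lemma ray_level xi n : boundary T xi -> level (xi n) = n.
Proof. by move=> /boundaryP/(_ n)[]. Qed.

Lemma ray_subtree xi m n : boundary T xi -> (m <= n)%N -> subtree (xi m) (xi n).
Proof.
move=> bx mn; rewrite /subtree /= !ray_level //.
by case: bx => _ ->; rewrite ?subnKC.
Qed.

Lemma level_finite n : locally_finite T -> finite_set [set v : T | level v = n].
Proof.
move=> lf; elim: n => [|n IH].
  by apply: sub_finite_set (finite_set1 (Defs.root T)) => v /level0.
apply: (sub_finite_set _ (bigcup_finite IH (fun v _ => lf v))) => v /= lv.
exists (parent v); first by rewrite /= level_parent lv.
by apply: adj_parent; rewrite lv.
Qed.

End TreeGeometry.

(** * Actions through a quotient and Property FW *)

Section Bijections.
Local Open Scope group_scope.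
Variable X : Type.

(** The permutation group of [X], in which the image of [G] acting on cosets presents the required
    quotient. *)
Record bijection := Bijection {
  bij_fun :> X -> X; bij_inv : X -> X;
  bij_funK : cancel bij_fun bij_inv; bij_invK : cancel bij_inv bij_fun }.

HB.instance Definition _ := gen_eqMixin bijection.
HB.instance Definition _ := gen_choiceMixin bijection.

Lemma bijection_ext (f g : bijection) : f =1 g -> f = g.
Proof.
case: f g => [f f' fK f'K] [g g' gK g'K] /= /funext fin_gen; subst g.
have fin_gen' : f' = g' by apply/funext => x; rewrite -{1}(g'K x) fK.
by subst g'; congr Bijection; apply: Prop_irrelevance.
Qed.

Definition bij_one : bijection := @Bijection id id (fun=> erefl) (fun=> erefl).

Definition bij_mul (f g : bijection) : bijection :=
  @Bijection (f \o g) (bij_inv g \o bij_inv f)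
    (can_comp (@bij_funK f) (@bij_funK g)) (can_comp (@bij_invK g) (@bij_invK f)).

Definition bij_invg (f : bijection) : bijection :=
  Bijection (@bij_invK f) (@bij_funK f).

Lemma bij_mulA : associative bij_mul.
Proof. by move=> f g h; apply: bijection_ext. Qed.

Lemma bij_mul1 : left_id bij_one bij_mul.
Proof. by move=> f; apply: bijection_ext. Qed.

Lemma bij_1mul : right_id bij_one bij_mul.
Proof. by move=> f; apply: bijection_ext. Qed.

Lemma bij_mulV : left_inverse bij_one bij_invg bij_mul.
Proof. by move=> f; apply: bijection_ext => x /=; rewrite bij_funK. Qed.

Lemma bij_Vmul : right_inverse bij_one bij_invg bij_mul.
Proof. by move=> f; apply: bijection_ext => x /=; rewrite bij_invK. Qed.

HB.instance Definition _ :=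
  isGroup.Build bijection bij_mulA bij_mul1 bij_1mul bij_mulV bij_Vmul.

End Bijections.

Section Factor.
Local Open Scope group_scope.
Variables (gT : groupType) (G H R : set gT).
Hypotheses (sG : is_subgroup G) (sR : is_subgroup R) (RG : R `<=` G) (fR : fin_index G R).
Hypothesis comm : forall a b, R a -> R b ->
  forall x, G x -> H (x^-1 * (a * b * a^-1 * b^-1) * x).
Hypothesis sH : is_subgroup H.

(** By [comm], commutators of [R] act trivially on [G/H], so [R] has abelian image of finite index
    in the image of [G]. *)
Lemma virtually_abelian_action : factors_through_virtually_abelian G H.
Proof.
(* The action is made trivial off [G/H], so that only the effect on cosets of [H] is seen;
   translation of all subsets would be faithful. *)
pose act g (C : set gT) := if `[< lcosets G H C >] then lcoset g C else C.
have actP g C : G g -> lcosets G H C -> act g C = lcoset g C /\ lcosets G H (act g C).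
  move=> Gg GC; rewrite /act asboolT //; split => //; exact: lcosets_act.
have actN g C : ~ lcosets G H C -> act g C = C by move=> nC; rewrite /act asboolF.
have actM g h C : G g -> G h -> act (g * h) C = act g (act h C).
  move=> Gg Gh; have [GC|nC] := pselect (lcosets G H C); last by rewrite !actN.
  have [hE hC] := actP h C Gh GC; rewrite (actP g _ Gg hC).1 hE.
  by rewrite (actP _ C _ GC).1 ?lcosetM //; grp.
have act1 C : act 1 C = C by rewrite /act lcoset1; case: ifP.
have actK g : G g -> cancel (act g) (act g^-1).
  by move=> Gg C; rewrite -actM ?mulVg //; grp.
have actVK g : G g -> cancel (act g^-1) (act g).
  by move=> Gg C; rewrite -actM ?mulgV //; grp.
pose pi g : bijection (set gT) :=
  if pselect (G g) is left Gg then Bijection (actK g Gg) (actVK g Gg) else 1.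
have piE g C : G g -> pi g C = act g C by rewrite /pi => Gg; case: pselect.
have piM g h : G g -> G h -> pi (g * h) = pi g * pi h.
  move=> Gg Gh; apply: bijection_ext => C.
  by rewrite [RHS]/= !piE ?actM //; grp.
have pi1 : pi 1 = 1.
  by apply: (mulgI (pi 1)); rewrite -piM ?mulg1 //; exact: subgroup1.
have piV g : G g -> pi g^-1 = (pi g)^-1.
  by move=> Gg; apply: (mulgI (pi g)); rewrite -piM ?mulgV ?pi1 //; grp.
have subP (M : set gT) : is_subgroup M -> M `<=` G -> is_subgroup (pi @` M).
  move=> sM MG; split.
  - by exists 1; [exact: subgroup1|].
  - move=> _ _ [x Mx <-] [y My <-]; exists (x * y); first by grp.
    by apply: piM; exact: MG.
  - by move=> _ [x Mx <-]; exists x^-1; [grp|apply/piV/MG].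
exists (bijection (set gT)), pi; split => //.
  exists (pi @` R); split; first exact: subP.
    split; first by move=> _ [r Rr <-]; exists r => //; exact: RG.
    apply/fi_lcosets; first exact: subP.
    have pre q : exists g, (pi @` G) q -> G g /\ pi g = q.
      have [[g Gg e]|no] := pselect ((pi @` G) q); first by exists g.
      by exists 1.
    have [p pP] := choice pre; have [I [f fI]] := fR.
    exists I, (fun q => f (p q)) => x y Gx Gy e.
    have [Gpx px] := pP _ Gx; have [Gpy py] := pP _ Gy.
    exists ((p x)^-1 * p y); first exact: fI.
    by rewrite piM ?piV ?px ?py //; grp.
  move=> _ _ [a Ra <-] [b Rb <-]; have Ga := RG Ra; have Gb := RG Rb.
  rewrite /commute -!piM //; apply: bijection_ext => C.
  rewrite !piE; try by grp.
  have [[x Gx <-]|nC] := pselect (lcosets G H C); last by rewrite !actN.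
  have GxH : lcosets G H (lcoset x H) by exists x.
  rewrite (actP _ _ _ GxH).1; last by grp.
  rewrite (actP _ _ _ GxH).1; last by grp.
  rewrite -!lcosetM; apply/lcoset_eq => //.
  have Rb' : R b^-1 by grp.
  have Ra' : R a^-1 by grp.
  by have := comm Rb' Ra' Gx; gsimp.
move=> g h Gg Gh e C GC; rewrite -(actP g C Gg GC).1 -(actP h C Gh GC).1.
by rewrite -!piE // e.
Qed.

End Factor.

(** * Property FW and coset spaces *)

Section PropertyFW.
Local Open Scope group_scope.
Variables (gT : groupType) (G : set gT).
Hypotheses (sG : is_subgroup G).
Notation lc := (@lcoset gT).

(** As [G] is transitive on [G/H], an invariant set contains [G/H] or misses it. *)
Lemma FW_transitive H A : property_FW G -> is_subgroup H -> A `<=` lcosets G H ->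
  almost_invariant G lc A -> finite_set A \/ finite_set (lcosets G H `\` A).
Proof.
move=> FW sH AX cA.
have [|B [BG fAB]] := FW _ lc (lcoset_action G) A.
  exact/(commensuratedP sG (lcoset_action G)).
move: fAB; rewrite /setY finite_setU => -[fAB fBA].
have [[_ [g Gg <-] Bg]|no] := pselect (exists2 x, lcosets G H x & B x).
  right; apply: sub_finite_set fBA => _ [[h Gh <-] nA]; split => //.
  have Ghg : G (h * g^-1) by grp.
  rewrite -(BG _ Ghg); exists (lc g H) => //.
  by rewrite -lcosetM mulgVK.
left; apply: sub_finite_set fAB => x Ax; split => // Bx; apply: no.
by exists x => //; apply: AX.
Qed.

Lemma infinite_seq (X : Type) (D : set X) (f : nat -> X) : (forall n, D (f n)) ->
  (forall m n, (m < n)%N -> f m <> f n) -> infinite_set D.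
Proof.
move=> Df finj finD; apply: infinite_nat.
have -> : [set: nat] = f @^-1` D by apply/seteqP; split => n // _; apply: Df.
apply: finite_preimage => // m n _ _ e.
by case: (ltngtP m n) => // /finj []; rewrite e.
Qed.

(* With [a] of infinite order modulo [H], the cosets [t * a ^ n * H] with
   [n >= 0] and [t] in a transversal of [<H, a>] form a half of the two-ended
   graph [G / H]. *)
Lemma FW_cyclic_extension H M a : property_FW G ->
  is_subgroup H -> is_subgroup M -> H `<=` M -> M `<=` G -> M a -> fin_index G M ->
  (forall h, H h -> H (a * h * a^-1)) -> (forall h, H h -> H (a^-1 * h * a)) ->
  (forall m, M m -> exists i j, H ((a ^+ j)^-1 * a ^+ i * m)) -> fin_index G H.
Proof.
move=> FW sH sM HM MG Ma fM Ha Ha' Mrep; apply: contrapT => nfi.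
have HG : H `<=` G by move=> h /HM/MG.
have Man n : M (a ^+ n) by elim: n => [|n IH]; [exact: subgroup1|rewrite expgS; grp].
have Hp n h : H h -> H (a ^+ n * h * (a ^+ n)^-1).
  by move=> Hh; elim: n => [|n /Ha]; rewrite ?expg0 ?expgS; gsimp.
have Hp' n h : H h -> H ((a ^+ n)^-1 * h * a ^+ n).
  by move=> Hh; elim: n => [|n /Ha']; rewrite ?expg0 ?expgSr; gsimp.
(* If a positive power of [a] lay in [H], then [M/H] would be finite cyclic and [H] of finite index
   in [G]. *)
have noH n : ~ H (a ^+ n.+1).
  move=> Hn; apply: nfi; apply: (fi_trans sG fM).
  have HnX k : H (a ^+ (n.+1 * k)).
    elim: k => [|k IH]; first by rewrite muln0; exact: subgroup1.
    by rewrite mulnS expgnDr; grp.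
  have rep m : exists e, M m -> H ((a ^+ e)^-1 * m).
    (* Modulo [H], [m] is [a] to the power [j - i]; as the power [n.+1] of [a] lies in [H], the
       exponent [- i] may be replaced by [n * i]. *)
    have [Mm|] := pselect (M m); last by exists 0%N.
    have [i [j Hij]] := Mrep m Mm; exists (n * i + j)%N => _.
    have := subgroupM sH (subgroupV sH (Hp' j _ (HnX i))) Hij.
    by rewrite mulSn expgnDr (expgnDr a (n * i)); gsimp.
  have [e He] := choice rep.
  exists 'I_n.+1, (fun m => inord (e m %% n.+1)) => x y Mx My /(congr1 val).
  rewrite /= !inordK ?ltn_pmod // => exy.
  have Hm m : M m -> H ((a ^+ (e m %% n.+1))^-1 * m).
    move=> Mm; have := He m Mm; rewrite {1}(divn_eq (e m) n.+1) addnC expgnDr.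
    move=> Hem; have := subgroupM sH (HnX (e m %/ n.+1)) Hem.
    by rewrite mulnC; gsimp.
  have := subgroupM sH (subgroupV sH (Hm x Mx)) (Hm y My).
  by rewrite exy; gsimp.
have rep C : exists r, lcosets G M C -> G r /\ lc r M = C.
  have [[r Gr rC]|no] := pselect (lcosets G M C); first by exists r.
  by exists 1.
have [r rP] := choice rep.
pose A := [set x | exists C n, lcosets G M C /\ x = lc (r C * a ^+ n) H].
have cA : almost_invariant G lc A.
  move=> g Gg.
  (* Once [n] is at least [i], the translate by [g] of the [n]-th coset over [C] is the coset over
     [lc g C] with the nonnegative exponent [j + (n - i)], again in [A]. *)
  have cut C : exists i, lcosets G M C -> forall n, (i <= n)%N ->
      A (lc g (lc (r C * a ^+ n) H)).
    have [GC|no] := pselect (lcosets G M C); last by exists 0%N.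
    have [Gr rC] := rP C GC.
    have GD : lcosets G M (lc g C) by apply: lcosets_act.
    have [Gs sD] := rP _ GD.
    have Mm : M ((r (lc g C))^-1 * (g * r C)).
      by apply/lcoset_eq => //; rewrite sD lcosetM rC.
    have [i [j Hij]] := Mrep _ Mm; exists i => _ n ni.
    exists (lc g C), (j + (n - i))%N; split => //.
    rewrite -lcosetM; apply/lcoset_eq => //.
    have := Hp' n _ (subgroupV sH Hij); rewrite expgnDr -{2}(subnKC ni) expgnDr.
    have c p q : a ^+ p * a ^+ q = a ^+ q * a ^+ p by rewrite -!expgnDr addnC.
    have e : (a ^+ i)^-1 * a ^+ j * a ^+ i = a ^+ j.
      by rewrite -mulgA (c j i) mulKg.
    gsimp; rewrite -!(mulgA _ (a ^+ j)) => Hx; move: Hx.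
    by rewrite !mulgA -(mulgA _ _ (a ^+ j)) -(mulgA _ _ (a ^+ i)) e; gsimp.
  have [i Hi] := choice cut.
  have finC : finite_set (lcosets G M) by apply/fi_lcosets.
  apply: (finite_rel (r := fun C x => exists2 n, `I_(i C) n & x = lc (r C * a ^+ n) H) finC).
    move=> C _; apply: (finite_inv (r := fun n => lc (r C * a ^+ n) H) (finite_II (i C))).
    by move=> x [n ni ->]; exists n.
  move=> x [[C [n [GC xE]]] nA]; exists C => //; exists n => //=.
  by rewrite ltnNge; apply/negP => ni; apply: nA; rewrite xE; apply: Hi.
have GM : lcosets G M M by exists 1; [exact: subgroup1|exact: lcoset1].
have [Gr rM] := rP M GM.
have GX C n : lcosets G M C -> lcosets G H (lc (r C * a ^+ n) H).
  move=> GC; exists (r C * a ^+ n) => //; have [Gr' _] := rP C GC.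
  by have Gn := MG _ (Man n); grp.
have AX : A `<=` lcosets G H by move=> x [C [n [GC ->]]]; apply: GX.
have dist m n : (m < n)%N -> ~ H ((a ^+ m)^-1 * a ^+ n).
  move=> mn; rewrite -(subnKC mn) addSnnS expgnDr mulKg; exact: noH.
case: (FW_transitive FW sH AX cA).
  apply: (infinite_seq (f := fun n => lc (r M * a ^+ n) H)) => [n|m n mn].
    by exists M, n.
  by move=> /(lcoset_eq _ _ sH); gsimp => Hmn; apply: (dist m n mn).
(* The negative powers of [a] give infinitely many cosets outside [A]; the shift to [n.+1] skips
   exponent 0, which belongs to [A]. *)
apply: (infinite_seq (f := fun n => lc (r M * (a ^+ n.+1)^-1) H)) => [n|m n mn].
  split; first by exists (r M * (a ^+ n.+1)^-1) => //; have := MG _ (Man n.+1) => Gn; grp.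
  move=> [C [k [GC /(lcoset_eq _ _ sH)]]]; gsimp => Hk.
  have [Grc rC] := rP C GC.
  have Mrc : M ((r M)^-1 * r C).
    have M1 := Man n.+1; have M2 := Man k; have Mk := HM _ Hk.
    have := subgroupM sM (subgroupM sM (subgroupV sM M1) Mk) (subgroupV sM M2).
    by gsimp.
  have CM : C = M.
    by apply: etrans (esym rC) (etrans _ rM); apply/esym/(lcoset_eq _ _ sM).
  by move: Hk; rewrite CM mulgVK -expgnDr; exact: noH.
move=> /(lcoset_eq _ _ sH); gsimp => Hmn; apply: (dist m.+1 n.+1) => //.
by have := subgroupV sH (Hp' m.+1 _ Hmn); gsimp.
Qed.

(** Start from [N] together with all generators of [R], of finite index, and drop the generators one
    by one. Commutators of [R] lie in [N], so each intermediate group is normalized by [R] and each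
    step is a cyclic extension. *)
Lemma FW_virtually_abelian N R : property_FW G ->
  is_subgroup N -> N `<=` G -> (forall x n, G x -> N n -> N (x * n * x^-1)) ->
  is_subgroup R -> R `<=` G -> fin_index G R -> fin_gen R ->
  (forall a b, R a -> R b -> N (a * b * a^-1 * b^-1)) -> fin_index G N.
Proof.
move=> FW sN NG nN sR RG fR [S [/finite_seqP[s sE] SR RS]] comm.
pose Hs (l : seq gT) := generated (N `|` [set` l]).
have sHs l : is_subgroup (Hs l) by apply: generated_subgroup.
have NHs l : N `<=` Hs l by move=> n Nn; apply: generated_gen; left.
have Hs0 : Hs [::] `<=` N by apply: generated_sub => // x [].
suff step l : {subset l <= [set` s]} -> fin_index G (Hs l) -> fin_index G N.
  apply: (step s) => [x|]; first by rewrite inE.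
  apply: fiS fR => // x /RS; apply: generated_sub; first exact: sHs.
  by rewrite sE => t ts; apply: generated_gen; right.
elim: l => [|a l IH] las fl; first exact: fiS fl.
have sR' t : t \in s -> R t by move=> ts; apply: SR; rewrite sE.
have aR : R a.
  by apply: sR'; have := las a (mem_head _ _); rewrite inE.
have lR t : t \in l -> R t.
  by move=> tl; apply: sR'; have := las t; rewrite inE tl orbT inE => /(_ isT).
have Ga := RG _ aR; apply: IH => [t tl|]; first by apply: las; rewrite inE tl orbT.
have HsG l' : (forall t, t \in l' -> R t) -> Hs l' `<=` G.
  by move=> lR'; apply: generated_sub => // x [/NG//|/lR'/RG].
have HG := HsG _ lR.
have Hc : forall b, R b -> forall h, Hs l h -> Hs l (b * h * b^-1).
  move=> b Rb h Hh; have Gb := RG _ Rb; have sH := sHs l.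
  have : [set h | G h /\ Hs l (b * h * b^-1)] h; last by case.
  move: h Hh; apply: generated_sub.
    split => [|x y [Gx Hx] [Gy Hy]|x [Gx Hx]]; split; try by grp.
    - by gsimp; exact: subgroup1.
    - by have := subgroupM sH Hx Hy; gsimp.
    - by have := subgroupV sH Hx; gsimp.
  move=> x [Nx|xl]; split.
  - exact: NG.
  - by apply: NHs; apply: nN.
  - by apply: RG; apply: lR.
  - have Rx := lR _ xl; have Hx : Hs l x by apply: generated_gen; right.
    by have := subgroupM sH (NHs l _ (comm _ _ Rb Rx)) Hx; gsimp.
have aR' : R a^-1 by grp.
have Ha' h : Hs l h -> Hs l (a^-1 * h * a).
  by move=> Hh; have := Hc _ aR' h Hh; rewrite invgK.
have sub : Hs l `<=` Hs (a :: l).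
  apply: generated_sub => // x [Nx|xl]; first exact: NHs.
  by apply: generated_gen; right; rewrite /= inE xl orbT.
have Ma : Hs (a :: l) a by apply: generated_gen; right; rewrite /= mem_head.
apply: (FW_cyclic_extension FW (sHs l) (sHs (a :: l)) sub _ Ma fl (Hc a aR) Ha').
  by apply: HsG => t; rewrite inE => /orP[/eqP->|/lR].
have sH := sHs l.
have Hp n h : Hs l h -> Hs l (a ^+ n * h * (a ^+ n)^-1).
  by move=> Hh; elim: n => [|n /(Hc a aR)]; rewrite ?expg0 ?expgS; gsimp.
have Hp' n h : Hs l h -> Hs l ((a ^+ n)^-1 * h * a ^+ n).
  by move=> Hh; elim: n => [|n /Ha']; rewrite ?expg0 ?expgSr; gsimp.
have c p q : a ^+ p * a ^+ q = a ^+ q * a ^+ p by rewrite -!expgnDr addnC.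
have c' p q : (a ^+ p)^-1 * a ^+ q = a ^+ q * (a ^+ p)^-1.
  by apply: (mulgI (a ^+ p)); rewrite mulVKg mulgA c mulgK.
apply: generated_sub.
  split.
  - by exists 0%N, 0%N; rewrite expg0; gsimp; exact: subgroup1.
  - move=> x y [i [j Hx]] [i' [j' Hy]]; exists (i + i')%N, (j + j')%N.
    have := subgroupM sH (Hp' j' _ (Hp i' _ Hx)) Hy; gsimp.
    rewrite expgnDr invgM (addnC i) expgnDr !mulgA.
    by rewrite -(mulgA (a ^+ j')^-1 (a ^+ j)^-1) (c' j i') !mulgA.
  - move=> x [i [j Hx]]; exists j, i.
    by have := Hp' i _ (Hp j _ (subgroupV sH Hx)); gsimp.
move=> x [Nx|]; first by exists 0%N, 0%N; rewrite expg0; gsimp; apply: NHs.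
rewrite /= inE => /orP[/eqP->|xl].
  by exists 0%N, 1%N; rewrite expg0 expg1; gsimp; exact: subgroup1.
by exists 0%N, 0%N; rewrite expg0; gsimp; apply: generated_gen; right.
Qed.

(** An orbit is a coset space, so [A] is finite or cofinite in it; by [pure_orbits], all but
    finitely many orbits lie in [A] or miss it. The invariant set is the union of the orbits that
    meet [A] in a nonempty cofinite part. *)
Lemma FW_of_cosets : fin_gen G ->
  (forall H A, is_subgroup H -> H `<=` G -> A `<=` lcosets G H ->
     almost_invariant G lc A -> finite_set A \/ finite_set (lcosets G H `\` A)) ->
  property_FW G.
Proof.
move=> fgG HG X act actP A /(commensuratedP sG actP) cA.
pose orb x := [set act g x | g in G].
have orb_refl x : orb x x by exists 1; [exact: subgroup1|rewrite (act1 actP)].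
have orb_eq x z : orb x z -> orb x = orb z.
  move=> [g Gg <-]; apply/seteqP; split => [_ [h Gh <-]|_ [h Gh <-]].
    exists (h * g^-1); first by grp.
    by rewrite (actM actP) ?(actK sG actP) //; grp.
  by exists (h * g); [grp|rewrite (actM actP)].
have orbA x : finite_set (orb x `&` A) \/ finite_set (orb x `\` A).
  pose H := [set g | G g /\ act g x = x].
  have sH : is_subgroup H.
    split => [|g h [Gg gx] [Gh hx]|g [Gg gx]]; split; try by grp.
    - exact: act1 actP x.
    - by rewrite (actM actP) // hx.
    - by rewrite -[in LHS]gx (actK sG actP).
  pose A' := [set C | exists g, [/\ G g, C = lc g H & A (act g x)]].
  have fun_r g h : G g -> G h -> lc g H = lc h H <-> act g x = act h x.
    move=> Gg Gh; split => [/(lcoset_eq _ _ sH)[_ e]|e].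
      have Gc : G (g^-1 * h) by grp.
      by rewrite -[in LHS]e -(actM actP) // mulVKg.
    apply/(lcoset_eq _ _ sH); split; first by grp.
    by rewrite (actM actP) -?e ?(actK sG actP) //; grp.
  have tr (D : set (set gT)) (E : set X) : finite_set D ->
      (forall z, E z -> exists g, [/\ G g, z = act g x & D (lc g H)]) -> finite_set E.
    move=> finD DE.
    apply: (finite_rel (r := fun C z => exists g, [/\ G g, z = act g x & C = lc g H]) finD).
      move=> C _; have [[z [g [Gg zE CE]]]|no] := pselect (exists z, exists g,
        [/\ G g, z = act g x & C = lc g H]); last first.
        by apply: (sub_finite_set _ (finite_set0 _)) => z rz; apply: no; exists z.
      apply: (sub_finite_set _ (finite_set1 z)) => z' [g' [Gg' z'E C'E]] /=.
      by rewrite zE z'E; apply/fun_r => //; rewrite -C'E -CE.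
    by move=> z /DE[g [Gg zE Dg]]; exists (lc g H) => //; exists g.
  have [||| |] := HG H A' sH.
  - by move=> g [].
  - by move=> _ [g [Gg -> _]]; exists g.
  - move=> g Gg; apply: (finite_rel (r := fun z C => exists c,
        [/\ G c, z = act c x & C = lc c H]) (cA g Gg)).
      move=> z _; have [[C [c [Gc zE CE]]]|no] := pselect (exists C, exists c,
        [/\ G c, z = act c x & C = lc c H]); last first.
        by apply: (sub_finite_set _ (finite_set0 _)) => C rC; apply: no; exists C.
      apply: (sub_finite_set _ (finite_set1 C)) => C' [c' [Gc' zE' C'E]] /=.
      by rewrite CE C'E; apply/fun_r => //; rewrite -zE -zE'.
    move=> _ [[c [Gc -> Ac]] nA]; exists (act c x); last by exists c.
    split => // Agc; apply: nA; exists (g * c); split; first by grp.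
      by rewrite lcosetM.
    by rewrite (actM actP).
  - move=> finA'; left; apply: (tr A') => // _ [[g Gg <-] Ag].
    by exists g; split => //; exists g.
  - move=> finA'; right; apply: (tr _ _ finA') => _ [[g Gg <-] nAg].
    exists g; split => //; split; first by exists g.
    by move=> [g' [Gg' /(fun_r _ _ Gg Gg') e Ag']]; apply: nAg; rewrite e.
have [V finV HV] := pure_orbits sG actP sG (fun _ => id) fgG cA.
have meetV x : orb x `&` A !=set0 -> orb x `\` A !=set0 -> exists2 v, V v & orb x v.
  move=> [_ [[g Gg <-] Ag]] [_ [[h Gh <-] nAh]]; apply: contrapT => no.
  have Vx k : G k -> ~ V (act k x).
    by move=> Gk Vk; apply: no; exists (act k x) => //; exists k.
  by apply: nAh; rewrite HV // -(HV x Vx g).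
(* Asking the orbit to meet [A] excludes finite orbits disjoint from [A], of which there may be
   infinitely many. *)
exists [set x | finite_set (orb x `\` A) /\ orb x `&` A !=set0]; split.
  move=> g Gg; apply/seteqP; split => [_ [x [fx nx] <-]|x [fx nx]].
    by rewrite /= -(orb_eq x) //; exists g.
  have Gg' := subgroupV sG Gg; exists (act g^-1 x); last exact: actVK sG actP _ _ Gg.
  by rewrite /= -(orb_eq x) //; exists g^-1.
rewrite /setY finite_setU; split.
  have fin v : V v -> finite_set [set x | [/\ orb x v, A x & ~ finite_set (orb x `\` A)]].
    move=> _; have [[x [xv Ax inf]]|no] := pselect (exists x,
        [/\ orb x v, A x & ~ finite_set (orb x `\` A)]); last first.
      by apply: (sub_finite_set _ (finite_set0 _)) => x rx; apply: no; exists x.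
    have [fA|//] := orbA x; apply: sub_finite_set fA => z [zv Az _]; split => //.
    by rewrite (orb_eq _ _ xv) -(orb_eq _ _ zv).
  apply: (finite_rel finV fin) => x [Ax nB].
  have inf : ~ finite_set (orb x `\` A) by move=> f; apply: nB; split => //; exists x.
  have [||v Vv xv] := meetV x; [by exists x|exact: infinite_setN0|].
  by exists v.
have fin v : V v -> finite_set [set x | [/\ orb x v, ~ A x & finite_set (orb x `\` A)]].
  move=> _; have [[x [xv nAx fA]]|no] := pselect (exists x,
      [/\ orb x v, ~ A x & finite_set (orb x `\` A)]); last first.
    by apply: (sub_finite_set _ (finite_set0 _)) => x rx; apply: no; exists x.
  apply: sub_finite_set fA => z [zv nAz _]; split => //.
  by rewrite (orb_eq _ _ xv) -(orb_eq _ _ zv).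
apply: (finite_rel finV fin) => x [[fB nB] nAx].
have [//||v Vv xv] := meetV x; first by exists x.
by exists v.
Qed.

End PropertyFW.

(** * Branch groups *)

Section Branch.
Local Open Scope group_scope.
Variables (T : rooted_tree) (G S : set (tree_aut T)).
Hypotheses (lf : locally_finite T) (sG : is_subgroup G).
Hypotheses (finS : finite_set S) (SV : forall s, S s -> S s^-1) (GS : generated S = G).
Hypotheses (transG : level_transitive G).
Hypothesis (ristG : forall n, finite_index G (rist_level G n)).
Hypothesis (infG : infinite_set G).
Implicit Types (u v w : T) (g h : tree_aut T) (xi eta : nat -> T) (D J P : set T).

Lemma autM g h w : (g * h) w = g (h w). Proof. by []. Qed.

Lemma autK g w : g^-1 (g w) = w.
Proof. by rewrite -autM mulVg. Qed.

Lemma autVK g w : g (g^-1 w) = w.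
Proof. by rewrite -autM mulgV. Qed.

Lemma aut_inj g w w' : g w = g w' -> w = w'.
Proof. by move=> /(congr1 (aut_fun g^-1)); rewrite !autK. Qed.

Lemma aut_moves g : g <> 1 -> exists w, g w <> w.
Proof.
move=> g1; apply: contrapT => no; apply: g1; apply: tree_aut_ext => w.
by apply: contrapT => gw; apply: no; exists w.
Qed.

(** A common form for rigid stabilizers and germ subgroups: [rist G v] is convertible to the fixer
    of the complement of [subtree v]. *)
Definition fixer P : set (tree_aut T) := [set g | G g /\ forall w, P w -> g w = w].

Definition below J : set T := [set w | exists2 v, J v & subtree v w].

Lemma fixer_subgroup P : is_subgroup (fixer P).
Proof.
split => [|g h [Gg Pg] [Gh Ph]|g [Gg Pg]]; split; try grp => //.
- by move=> w Pw; rewrite autM Ph ?Pg.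
- by move=> w Pw; apply: (@aut_inj g); rewrite autVK Pg.
Qed.

Lemma fixerG P : fixer P `<=` G. Proof. by move=> g []. Qed.

Lemma fixerS P P' : P `<=` P' -> fixer P' `<=` fixer P.
Proof. by move=> PP g [Gg Pg]; split => // w /PP/Pg. Qed.

Lemma fixer_commute P P' k l : (forall w, P w \/ P' w) -> fixer P k -> fixer P' l ->
  k * l = l * k.
Proof.
move=> PP [_ Pk] [_ Pl]; apply: tree_aut_ext => w; rewrite !autM.
suff H Q Q' (a b : tree_aut T) : (forall w, Q w \/ Q' w) -> (forall w, Q w -> a w = w) ->
    (forall w, Q' w -> b w = w) -> Q w -> a (b w) = b (a w).
  case: (PP w) => Pw; first exact: (H P P').
  by symmetry; apply: (H P' P) => // w'; have [] := PP w'; auto.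
move=> QQ Qa Qb Qw; rewrite (Qa w) //.
by have [/Qa//|/Qb/aut_inj bw] := QQ (b w); rewrite bw Qa.
Qed.

Lemma fixer_conj P P' x g : G x -> (forall w, P' w -> P (x^-1 w)) -> fixer P g ->
  fixer P' (x * g * x^-1).
Proof.
move=> Gx PP [Gg Pg]; split; first by grp.
by move=> w /PP Pw; rewrite !autM Pg // autVK.
Qed.

Lemma rist_fix v g w : rist G v g -> (level w <= level v)%N -> g w = w.
Proof.
move=> [Gg gv] wv; have [vw|/gv//] := pselect (subtree v w).
have e : v = w.
  by apply: subtree_eq => //; apply/eqP; rewrite eqn_leq wv subtree_level.
have [vg|/gv/aut_inj//] := pselect (subtree v (g w)).
by rewrite -{2}e; symmetry; apply: subtree_eq => //; rewrite aut_level e.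
Qed.

Lemma rist_conj v g x : G x -> rist G v g -> rist G (x v) (x * g * x^-1).
Proof.
move=> Gx; apply: fixer_conj => // w nxw /=; rewrite -(aut_subtree x).
by rewrite autVK.
Qed.

Lemma rist_sub u v : subtree u v -> rist G v `<=` rist G u.
Proof.
move=> uv; apply: fixerS => w /= nuw vw; apply: nuw; exact: subtree_trans uv vw.
Qed.

Lemma rist_subtree v g w : rist G v g -> subtree v w -> subtree v (g w).
Proof. by move=> gv vw; rewrite -{1}(rist_fix gv (leqnn _)) aut_subtree. Qed.

Lemma rist_level_fix n g w : rist_level G n g -> (level w <= n)%N -> g w = w.
Proof.
move=> gn wn; suff : fixer [set w | (level w <= n)%N] g by case=> _; apply.
move: g gn; apply: generated_sub; first exact: fixer_subgroup.
move=> g [v /= lv gv]; split => [|w' /= wn']; first by case: gv.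
by apply: rist_fix gv _; rewrite lv.
Qed.

Lemma fi_rist_level n : fin_index G (rist_level G n).
Proof.
apply/fi_lcosets; first exact: generated_subgroup.
by have [] := ristG n.
Qed.

Lemma fi_level_stab n : fin_index G (fixer [set w | (level w <= n)%N]).
Proof.
apply: fiS (fi_rist_level n) => // g gn; split => [|w wn].
  by have [+ _] := ristG n; apply.
exact: rist_level_fix gn wn.
Qed.

(** Otherwise the trivial group would have finite index in the infinite group [G]. *)
Lemma rist_nontrivial_level n : exists2 v, level v = n & exists2 g, rist G v g & g <> 1.
Proof.
apply: contrapT => no; apply: infG; apply: (fi_finite sG (fi_rist_level n)).
apply: (sub_finite_set _ (finite_set1 (1 : tree_aut T))).
apply: generated_sub.
  by split => [|x y /= -> ->|x /= ->]; rewrite /= ?mulg1 ?invg1.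
move=> g [v lv gv] /=; apply: contrapT => g1; apply: no; exists v => //.
by exists g.
Qed.

Lemma level_nonempty n : exists v, level v = n.
Proof. by have [v lv _] := rist_nontrivial_level n; exists v. Qed.

Lemma descendant_ex u n : (level u <= n)%N -> exists2 v, level v = n & subtree u v.
Proof.
move=> un; have [v lv] := level_nonempty n.
have [|u' lu' u'v] := @anc_ex T (level u) v; first by rewrite lv.
have [g Gg gu] := transG lu'; exists (g v); first by rewrite aut_level.
by rewrite -gu aut_subtree.
Qed.

(** If it were finite, every nontrivial element would move a vertex of level at most some [n]. The
    rigid stabilizer of a descendant of [u] at level [n] is nontrivial and fixes all these
    vertices. *)
Lemma rist_infinite u : infinite_set (rist G u).
Proof.
move=> finR.
have wit g : exists w, g <> 1 -> g w <> w.
  by have [->|/aut_moves[w gw]] := pselect (g = 1); [exists u|exists w].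
have [f Hf] := choice wit.
have /finite_seqP[s sE] := finite_image (fun g => level (f g)) finR.
pose n := maxn (level u) (\max_(i <- s) i).
have fn g : rist G u g -> (level (f g) <= n)%N.
  move=> gu; apply: leq_trans (leq_maxr _ _).
  apply: (@leq_bigmax_seq _ s xpredT id) => //.
  have : [set` s] (level (f g)) by rewrite -sE; exists g.
  by [].
have [v lv [g gv g1]] := rist_nontrivial_level n.
have [v' lv' uv'] := descendant_ex (leq_maxl (level u) (\max_(i <- s) i)).
have [x Gx xv] : exists2 x, G x & x v = v' by apply: transG; rewrite lv lv'.
have gv' : rist G v' (x * g * x^-1) by rewrite -xv; apply: rist_conj.
have gu := rist_sub uv' gv'; apply: (Hf (x * g * x^-1)).
  by move=> /divg1_eq e; apply: g1; apply: (mulgI x); rewrite mulg1.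
by apply: rist_fix gv' _; rewrite lv'; apply: fn.
Qed.

Lemma fi_rist_nontrivial N u : is_subgroup N -> fin_index G N ->
  exists b, [/\ N b, rist G u b & b <> 1].
Proof.
move=> sN fN; have [x [y [xu yu xy Nxy]]] := fi_pigeon fN (@fixerG _) (@rist_infinite u).
have sR : is_subgroup (rist G u) by apply: fixer_subgroup.
exists (x^-1 * y); split => //; first by grp.
by move=> /mulg1_eq; rewrite invgK.
Qed.

Definition normal_in N := [/\ is_subgroup N, N `<=` G & forall x n, G x -> N n -> N (x * n * x^-1)].

Lemma commutator_mod N U : normal_in N -> U `<=` G ->
  (forall a b, U a -> U b -> N (a * b * a^-1 * b^-1)) ->
  forall a b, generated U a -> generated U b -> N (a * b * a^-1 * b^-1).
Proof.
move=> [sN NG nN] UG comm.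
have sC b : G b -> is_subgroup [set a | G a /\ N (a * b * a^-1 * b^-1)].
  move=> Gb; split => [|x y [Gx Nx] [Gy Ny]|x [Gx Nx]]; split; try by grp.
  - by gsimp; apply: subgroup1.
  - by have := subgroupM sN (nN _ _ Gx Ny) Nx; gsimp.
  - have := nN x^-1 _ (subgroupV sG Gx) (subgroupV sN Nx); by gsimp.
have GU : generated U `<=` G by apply: generated_sub.
have half a b : generated U a -> U b -> N (a * b * a^-1 * b^-1).
  move=> Ua Ub; have : [set a | G a /\ N (a * b * a^-1 * b^-1)] a.
    move: a Ua; apply: generated_sub; first by apply: sC; apply: UG.
    by move=> a Ua; split; [apply: UG|apply: comm].
  by case.
move=> a b Ua Ub; have : [set b | G b /\ N (b * a * b^-1 * a^-1)] b.
  move: b Ub; apply: generated_sub; first by apply: sC; apply: GU.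
  move=> b Ub; split; first exact: UG.
  by have := subgroupV sN (half _ _ Ua Ub); gsimp.
by case=> _ Nba; have := subgroupV sN Nba; gsimp.
Qed.

(* If [g u <> u] and [a], [b] are in [RiSt(u)], then [g a g^-1] commutes with [b],
   so [[g, a], b] is a commutator of two elements of [RiSt(u)]. *)
Lemma normal_commutators N g : normal_in N -> N g -> g <> 1 -> exists n,
  forall a b, rist_level G n a -> rist_level G n b -> N (a * b * a^-1 * b^-1).
Proof.
move=> nN Ng /aut_moves[u gu]; have [sN NG nN'] := nN.
have Gg := NG _ Ng; exists (level u).
have disj v v' a b : v <> v' -> level v = level v' -> rist G v a -> rist G v' b ->
    a * b = b * a.
  move=> vv' l; apply: fixer_commute => w /=.
  have [vw|] := pselect (subtree v w); last by left.
  by right => v'w; apply: vv'; apply: subtree_inj vw v'w l.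
have cu a b : rist G u a -> rist G u b -> N (b * a * b^-1 * a^-1).
  move=> au bu; have Ga : G a by case: au.
  have Gb : G b by case: bu.
  have sR : is_subgroup (rist G u) by apply: fixer_subgroup.
  have au' : rist G u a^-1 by grp.
  have [c cE cgu] : exists2 c, c = g * a^-1 * g^-1 & rist G (g u) c.
    by exists (g * a^-1 * g^-1) => //; apply: rist_conj.
  have cb : c * b = b * c by apply: disj cgu bu => //; rewrite aut_level.
  have ck : c * (b * a * b^-1 * a^-1) = b * a * b^-1 * a^-1 * c.
    by apply: (disj (g u) u) => //; [rewrite aut_level|grp].
  have Nm : N (c * a).
    have := subgroupM sN Ng (nN' a^-1 _ (subgroupV sG Ga) (subgroupV sN Ng)).
    by rewrite cE; gsimp.
  have := subgroupM sN (nN' b _ Gb Nm) (subgroupV sN Nm).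
  have -> // : b * (c * a) * b^-1 * (c * a)^-1 = b * a * b^-1 * a^-1.
  by rewrite invgM !mulgA -cb -[RHS](mulgK c) -ck !mulgA.
apply: commutator_mod => // [g' [v _ [Gg' _]]//|a b [v /= lv av] [w /= lw bw]].
(* Rigid stabilizers of distinct vertices of one level commute; for equal vertices, transitivity
   moves [v] to [u]. *)
have [e|ne] := pselect (v = w); last first.
  rewrite (disj _ _ _ _ ne _ av bw) ?lv ?lw //; gsimp; exact: subgroup1.
rewrite -{}e in bw; have [x Gx xv] : exists2 x, G x & x v = u by apply: transG.
have au : rist G u (x * a * x^-1) by rewrite -xv; apply: rist_conj.
have bu : rist G u (x * b * x^-1) by rewrite -xv; apply: rist_conj.
by have := nN' x^-1 _ (subgroupV sG Gx) (cu _ _ bu au); gsimp.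
Qed.

Lemma fg_G : fin_gen G.
Proof. by exists S; rewrite GS; split => // s Ss; rewrite -GS; apply: generated_gen. Qed.

(** Every rigid stabilizer of level [n] lies in one of the two factors, so the product contains
    [rist_level G n]. *)
Lemma below_prod J n : J `<=` [set v | level v = n] ->
  fin_index G (prodg (fixer (~` below J)) (fixer (below J))).
Proof.
move=> Jn; apply: fiS (fi_rist_level n) => //; apply: generated_sub.
  apply: prodg_subgroup; [exact: fixer_subgroup..|move=> k l].
  by apply: fixer_commute => w; rewrite or_comm; apply: lem.
move=> g [v /= lv gv]; have [Jv|nJv] := pselect (J v).
  exists g, 1; rewrite mulg1; split => //; last exact: subgroup1 (fixer_subgroup _).
  by apply: fixerS gv => w /= nD vw; apply: nD; exists v.
exists 1, g; rewrite mul1g; split => //; first exact: subgroup1 (fixer_subgroup _).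
apply: fixerS gv => w /= [v' Jv' v'w] vw; apply: nJv.
by rewrite (subtree_inj vw v'w) // (Jn _ Jv').
Qed.

Lemma fixer_below_commute J k l : fixer (~` below J) k -> fixer (below J) l ->
  k * l = l * k.
Proof. by apply: fixer_commute => w; rewrite or_comm; apply: lem. Qed.

Lemma fixer_below_trivial J g : fixer (~` below J) g -> fixer (below J) g -> g = 1.
Proof.
move=> [_ g1] [_ g2]; apply: tree_aut_ext => w.
by have [/g2|/g1] := pselect (below J w).
Qed.

(** Both are factors of a direct product of finite index in the finitely generated group [G]. *)
Lemma fg_fixer_below J n : J `<=` [set v | level v = n] ->
  fin_gen (fixer (~` below J)) /\ fin_gen (fixer (below J)).
Proof.
move=> Jn; have fp := below_prod Jn.
have s1 := fixer_subgroup (~` below J); have s2 := fixer_subgroup (below J).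
have c12 := @fixer_below_commute J.
have fgP : fin_gen (prodg (fixer (~` below J)) (fixer (below J))).
  apply: fg_fi fg_G fp => //; first exact: prodg_subgroup.
  by move=> _ [k [l [/fixerG Gk /fixerG Gl ->]]]; grp.
have fgP' : fin_gen (prodg (fixer (below J)) (fixer (~` below J))).
  suff <- : prodg (fixer (~` below J)) (fixer (below J)) =
            prodg (fixer (below J)) (fixer (~` below J)) by [].
  apply/seteqP; split => _ [k [l [k1 l1 ->]]]; exists l, k; split => //.
    exact: c12.
  exact/esym/c12.
split; [apply: fg_factor fgP|apply: fg_factor fgP'] => //.
- exact: fixer_below_trivial.
- by move=> k l k1 l1; apply/esym/c12.
- by move=> x x1 x2; apply: (@fixer_below_trivial J).
Qed.

Lemma comm_agree (Q : set T) (f g a b : tree_aut T) :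
  (forall u, Q u -> f u = a u) -> (forall u, Q u -> g u = b u) ->
  (forall u, Q u -> Q (a u) /\ Q (a^-1 u)) -> (forall u, Q u -> Q (b u) /\ Q (b^-1 u)) ->
  forall u, Q u -> (f * g * f^-1 * g^-1) u = (a * b * a^-1 * b^-1) u.
Proof.
move=> fa gb Qa Qb u Qu.
have inv (f' a' : tree_aut T) : (forall u, Q u -> f' u = a' u) ->
    (forall u, Q u -> Q (a' u) /\ Q (a'^-1 u)) -> forall u, Q u -> f'^-1 u = a'^-1 u.
  move=> e Qa' u' Qu'; apply: (@aut_inj f'); rewrite autVK e ?autVK //.
  by have [] := Qa' u' Qu'.
rewrite !autM (inv g b) //; have [_ Qu1] := Qb u Qu.
rewrite (inv f a) //; have [_ Qu2] := Qa _ Qu1.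
by rewrite gb // fa //; have [] := Qb _ Qu2.
Qed.

Lemma subtree_stable v g : g v = v ->
  forall u, subtree v u -> subtree v (g u) /\ subtree v (g^-1 u).
Proof.
move=> gv u vu; split; first by rewrite -gv aut_subtree.
have <- : g^-1 v = v by rewrite -{1}gv autK.
by rewrite aut_subtree.
Qed.

Lemma belowP v w u : below [set v; w] u <-> subtree v u \/ subtree w u.
Proof.
split => [[_ [->|->]]|[vu|wu]]; [by left|by right| |].
  by exists v => //; left.
by exists w => //; right.
Qed.

Lemma below1P v u : below [set v] u <-> subtree v u.
Proof. by split => [[_ ->]|vu] //; exists v. Qed.

Lemma parent_subtree (v : T) : subtree (parent v) v.
Proof.
have [v0|v0] := posnP (level v).
  have -> : parent v = v; last exact: subtree_refl.
  by rewrite (level0 v0); apply: level0; rewrite level_parent level_root.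
by apply/subtreeP; rewrite level_parent leq_pred -subn1 subKn.
Qed.

Lemma ray_moved g xi j k : boundary T xi -> (j <= k)%N -> g (xi j) <> xi j ->
  g (xi k) <> xi k.
Proof.
move=> bx jk gj gk; apply: gj; apply: (@subtree_inj _ _ _ (xi k)).
- by rewrite -gk aut_subtree; apply: ray_subtree.
- exact: ray_subtree.
- by rewrite aut_level.
Qed.

Lemma stabP (H : set (tree_aut T)) h : is_subgroup H -> lcoset h H = H <-> H h.
Proof.
move=> sH; have := lcoset_eq 1 h sH; rewrite lcoset1 invg1 mul1g => <-.
by split=> e; symmetry.
Qed.

(** * Big and small sets of vertices for a subgroup *)

Section Subgroup.
Variable H : set (tree_aut T).
Hypotheses (sH : is_subgroup H) (HG : H `<=` G).
Notation Big := (big G (@lcoset (tree_aut T)) H).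

Lemma big_elim L : Big L -> exists M, [/\ is_subgroup M, M `<=` G, fin_index G M &
  forall g, M g -> exists2 l, L l & H (l^-1 * g)].
Proof.
move=> [M [sM MG fM HM]]; exists M; split => // g /HM[l Ll e]; exists l => //.
exact/(lcoset_eq _ _ sH)/esym.
Qed.

(** Fixing all levels up to [m] makes an element preserve each subtree rooted at level [m], so
    commutators can be computed subtree by subtree. *)
Definition trunk m v w : set T :=
  [set u | (level u <= m)%N \/ below [set v; w] u].

(* The element is an iterated commutator, with one entry supported below a fixed
   vertex and trivial below [w] for each other vertex [w] of level [m]. *)
Lemma big_pairs_core m :
  (forall v w, level v = m -> level w = m -> Big (fixer (trunk m v w))) ->
  exists a, [/\ G a, a <> 1 & forall x, G x -> H (x^-1 * a * x)].
Proof.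
move=> HB.
have MP (d : T * T) : exists M, level d.1 = m -> level d.2 = m ->
    [/\ is_subgroup M, fin_index G M &
        forall g, M g -> exists2 l, fixer (trunk m d.1 d.2) l & H (l^-1 * g)].
  have [e1|n1] := pselect (level d.1 = m); last by exists G.
  have [e2|n2] := pselect (level d.2 = m); last by exists G.
  by have [M [sM _ fM HM]] := big_elim (HB _ _ e1 e2); exists M.
have [M HM] := choice MP.
have /finite_seqP[s sE] := level_finite m lf.
have sP w : w \in s <-> level w = m.
  have : [set` s] w <-> [set v | level v = m] w by rewrite -sE.
  by [].
pose N0 (ds : seq (T * T)) := [set g | G g /\ forall d, d \in ds ->
  level d.1 = m -> level d.2 = m -> M d g].
have N0P ds : is_subgroup (N0 ds) /\ fin_index G (N0 ds).
  split.
    split => [|g h [Gg Mg] [Gh Mh]|g [Gg Mg]]; split; try by grp.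
    - by move=> d _ e1 e2; have [sM _ _] := HM d e1 e2; grp.
    - by move=> d dds e1 e2; have [sM _ _] := HM d e1 e2; apply: subgroupM; auto.
    - by move=> d dds e1 e2; have [sM _ _] := HM d e1 e2; apply: subgroupV; auto.
  elim: ds => [|d ds IH].
    by exists unit, (fun=> tt) => x y Gx Gy _; split => //; grp.
  have fd : fin_index G [set g | G g /\ (level d.1 = m -> level d.2 = m -> M d g)].
    have [[e1 e2]|no] := pselect (level d.1 = m /\ level d.2 = m).
      have [sM [I [f fM]] _] := HM d e1 e2; exists I, f => x y Gx Gy e.
      by split => [|_ _]; [grp|apply: fM].
    exists unit, (fun=> tt) => x y Gx Gy _; split => [|e1 e2]; first by grp.
    by case: no.
  apply: fiS (fiI fd IH) => // g [[Gg Mg] [_ Mgs]]; split => // d'.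
  by rewrite inE => /orP[/eqP->|/Mgs].
pose N := core G (N0 (allpairs pair s s)).
have [sN0 fN0] := N0P (allpairs pair s s).
have sN : is_subgroup N by apply: core_subgroup.
have fN : fin_index G N by apply: fi_core.
(* Bigness for the pair [x^-1 v], [x^-1 w] corrects [x^-1 * a * x] into [H] by an element fixing
   their trunk. Conjugating back changes nothing below [v] and [w]. *)
have agree x v w a : G x -> level v = m -> level w = m -> N a ->
    (forall u, (level u <= m)%N -> a u = u) -> exists h, [/\ H (x^-1 * h * x),
      forall u, (level u <= m)%N -> h u = u & forall u, below [set v; w] u -> h u = a u].
  move=> Gx lv lw Na am; have Nax := core_conj sG Na Gx.
  have l1 : level (x^-1 v) = m by rewrite aut_level.
  have l2 : level (x^-1 w) = m by rewrite aut_level.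
  have [_ _ Hl] := HM (x^-1 v, x^-1 w) l1 l2.
  have [|l fl Hla] := Hl (x^-1 * a * x).
    have [_ ]:= core_sub sG Nax; apply => //; apply/allpairsP.
    by exists (x^-1 v, x^-1 w); split => //=; apply/sP.
  have [_ fl'] := subgroupV (fixer_subgroup _) fl.
  exists (x * l^-1 * x^-1 * a); split.
  - by move: Hla; gsimp.
  - by move=> u um; rewrite !autM am // fl' ?autVK //; left; rewrite aut_level.
  - move=> u vu; rewrite !autM fl' ?autVK //; right; apply/belowP.
    rewrite !aut_subtree; move/belowP: vu => [vu|wu]; [left|right].
      by rewrite -(am v) ?lv // aut_subtree.
    by rewrite -(am w) ?lw // aut_subtree.
have [v lv] := level_nonempty m.
(* For each [x], the element [h] lies in the conjugate of [H] by [x], agrees with [a] below [v] and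
   is trivial below the vertices treated so far. Once all of level [m] is treated, [h] equals
   [a]. *)
suff /(_ s)[a [Na av a1 Ha]] : forall ws : seq T, exists a, [/\ N a, rist G v a, a <> 1 &
    forall x, G x -> exists h, [/\ H (x^-1 * h * x), forall u, (level u <= m)%N -> h u = u,
      forall u, subtree v u -> h u = a u &
      forall w, w \in ws -> level w = m -> w <> v -> forall u, subtree w u -> h u = u]].
  exists a; split => // [|x Gx]; first by case: av.
  have [h [Hh hm hv hw]] := Ha x Gx; suff <- : h = a by [].
  apply: tree_aut_ext => u; have [um|mu] := leqP (level u) m.
    by rewrite hm // (rist_fix av) // lv.
  have [w lw wu] := anc_ex (ltnW mu).
  have [e|wv] := pselect (w = v); first by apply: hv; rewrite -e.
  rewrite (hw w) //; last exact/sP.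
  by have [_ ->] := av => // vu; apply: wv; apply: subtree_inj wu vu _; rewrite lw lv.
elim=> [|w ws [a [Na av a1 Ha]]].
  have [b [Nb bv b1]] := fi_rist_nontrivial v sN fN.
  exists b; split => // x Gx.
  have bm u : (level u <= m)%N -> b u = u by rewrite -lv; apply: rist_fix.
  have [h [Hh hm hv]] := agree x v v b Gx lv lv Nb bm; exists h; split => //.
  by move=> u vu; apply: hv; apply/belowP; left.
have [[lw wv]|triv] := pselect (level w = m /\ w <> v); last first.
  exists a; split => // x Gx; have [h [Hh hm hv hw]] := Ha x Gx; exists h; split => //.
  move=> w'; rewrite inE => /orP[/eqP-> lw wv|/hw//]; by case: triv.
(* Taking [b] supported below a vertex [u] moved by [a] makes [b] and its conjugate by [a] have
   disjoint supports, so the commutator is nontrivial. *)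
have [u au] := aut_moves a1.
have vu : subtree v u by apply: contrapT => nvu; apply: au; have [_ ->] := av.
have [b [Nb bu b1]] := fi_rist_nontrivial u sN fN.
have bv := rist_sub vu bu.
have sR : is_subgroup (rist G v) by apply: fixer_subgroup.
exists (a * b * a^-1 * b^-1); split; [by grp|by grp| |].
  move=> /divg1_eq e; have {}e : a * b = b * a by rewrite -{2}e mulgVK.
  have [u1 bu1] := aut_moves b1.
  have uu1 : subtree u u1 by apply: contrapT => nu; apply: bu1; have [_ ->] := bu.
  have : (a * b) u1 = a u1.
    rewrite e autM; have [_ -> //] := bu => uau1; apply: au.
    apply: subtree_inj _ uau1 _; last by rewrite aut_level.
    by rewrite aut_subtree.
  by rewrite autM => /aut_inj.
move=> x Gx; have [h [Hh hm hv hw]] := Ha x Gx.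
have bm u' : (level u' <= m)%N -> b u' = u' by rewrite -lv; apply: rist_fix.
(* Below [w] the element [k] agrees with [b], hence is trivial. So the commutator of [h] and [k] is
   trivial below [w] and wherever [h] was. *)
have [k [Hk km kvw]] := agree x v w b Gx lv lw Nb bm.
have fixm g w' : level w' = m -> (forall u, (level u <= m)%N -> g u = u) -> g w' = w'.
  by move=> lw' ->; rewrite ?lw'.
exists (h * k * h^-1 * k^-1); split.
- have -> : x^-1 * (h * k * h^-1 * k^-1) * x = (x^-1 * h * x) * (x^-1 * k * x) *
    (x^-1 * h * x)^-1 * (x^-1 * k * x)^-1 by gsimp.
  by grp.
- move=> u' um; rewrite -[RHS](_ : (1 * 1 * 1^-1 * 1^-1 : tree_aut T) u' = u'); last by gsimp.
  apply: (@comm_agree [set u | (level u <= m)%N]) => // u1 /=; by rewrite ?invg1.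
- apply: comm_agree => //.
  + by move=> u' vu'; apply: kvw; apply/belowP; left.
  + by apply: subtree_stable; apply: rist_fix av _.
  + by apply: subtree_stable; apply: rist_fix bv _.
- move=> w'; rewrite inE => /orP[/eqP->|w'ws] lw' w'v u' wu'.
    rewrite (@comm_agree (subtree w) _ _ h 1) //; first by gsimp.
    + move=> u1 wu1; rewrite kvw; last by apply/belowP; right.
      have [_ ->] := bv => // vu1; apply: wv.
      by apply: subtree_inj wu1 vu1 _; rewrite lw lv.
    + by apply: subtree_stable; apply: fixm.
    + by move=> u1; rewrite invg1.
  rewrite (@comm_agree (subtree w') _ _ 1 k) //; first by gsimp.
  + by apply: hw.
  + by move=> u1; rewrite invg1.
  + by apply: subtree_stable; apply: fixm.
Qed.

(** The fixer of the trunk has finite index in that of the two subtrees and is normalized by the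
    stabilizer of the levels up to [m], so [big_fi] applies. *)
Lemma big_trunk m v w : level v = m -> level w = m ->
  Big (fixer (below [set v; w])) -> Big (fixer (trunk m v w)).
Proof.
move=> lv lw; have fs := fi_level_stab m.
apply: (big_fi (R := fixer [set u | (level u <= m)%N]) sG (lcoset_action G)) => //.
- exact: fixer_subgroup.
- exact: fixerG.
- exact: fixer_subgroup.
- by apply: fixerS => u ?; right.
- have fs' : fin_index (fixer (below [set v; w])) (fixer (below [set v; w]) `&`
      fixer [set u | (level u <= m)%N]).
    have [I [f fI]] := fs; exists I, f => x y [Gx Px] [Gy Py] e; split.
      have sF := fixer_subgroup (below [set v; w]).
      have Fx : fixer (below [set v; w]) x by [].
      have Fy : fixer (below [set v; w]) y by [].
      by grp.
    exact: fI.
  apply: fiS fs' => // g [[Gg g1] [_ g2]]; split => // u [/g2|/g1] //.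
- exact: fixer_subgroup.
- exact: fixerG.
- move=> r l [Gr rm] [Gl Hl]; split; first by grp.
  have rv : r v = v by apply: rm; rewrite /= lv.
  have rw : r w = w by apply: rm; rewrite /= lw.
  move=> u Pu; rewrite !autM Hl ?autK //.
  case: Pu => [um|/belowP Pu]; first by left; rewrite aut_level.
  right; apply/belowP; case: Pu => [vu|wu]; [left|right].
    by rewrite -rv aut_subtree.
  by rewrite -rw aut_subtree.
Qed.

(** * The ray determined by a commensurated set *)

Section TwoEnded.
Hypothesis faithfulH : forall a, G a -> (forall x, G x -> H (x^-1 * a * x)) -> a = 1.
Variable A : set (set (tree_aut T)).
Hypothesis cA : almost_invariant G (@lcoset (tree_aut T)) A.
Hypothesis iA : infinite_set [set x | (exists2 g, G g & x = lcoset g H) /\ A x].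
Hypothesis inA : infinite_set [set x | (exists2 g, G g & x = lcoset g H) /\ ~ A x].

Lemma small_pair m : exists v w,
  [/\ level v = m, level w = m & ~ Big (fixer (below [set v; w]))].
Proof.
apply: contrapT => no; have [|a [Ga a1 Ha]] := @big_pairs_core m.
  move=> v w lv lw; apply: big_trunk => //; apply: contrapT => nB; apply: no.
  by exists v, w.
by apply: a1; apply: faithfulH.
Qed.

Lemma big_below n J : J `<=` [set v | level v = n] ->
  Big (fixer (~` below J)) \/ Big (fixer (below J)).
Proof.
move=> Jn; have [f1 f2] := fg_fixer_below Jn.
apply: (dichotomy sG (lcoset_action G) (A := A)) => //.
- exact: fixer_subgroup.
- exact: fixer_subgroup.
- exact: fixerG.
- exact: fixerG.
- exact: fixer_below_commute.
- exact: below_prod Jn.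
Qed.

(** If they were disjoint, the fixer of the complement of [below J], big by the dichotomy, would be
    contained in the fixer of [below J']. *)
Lemma small_meet n J J' : J `<=` [set v | level v = n] -> J' `<=` [set v | level v = n] ->
  ~ Big (fixer (below J)) -> ~ Big (fixer (below J')) -> J `&` J' !=set0.
Proof.
move=> Jn J'n nB nB'; apply: contrapT => disj; have [B|//] := big_below Jn.
apply: nB'; apply: bigS B; apply: fixerS => w [v J'v vw] [v' Jv' v'w].
apply: disj; exists v; split => //; suff -> : v = v' by [].
by apply: subtree_inj vw v'w _; rewrite (Jn _ Jv') (J'n _ J'v).
Qed.

Lemma small_conj h J : H h -> ~ Big (fixer (below J)) -> ~ Big (fixer (below (h @` J))).
Proof.
move=> Hh nB B; apply: nB; have Gh := HG Hh.
apply: (big_conj sG (lcoset_action G) (h := h^-1) _ _ _ _ B).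
- exact: fixerG.
- by grp.
- by apply/(stabP _ sH); grp.
move=> l fl; apply: fixer_conj fl; first by grp.
move=> w [v Jv vw]; rewrite invgK; exists (h v); first by exists v.
by rewrite aut_subtree.
Qed.

(** Parents of a small pair form a small pair, since their subtrees are larger; Koenig's lemma
    applies. *)
Lemma small_rays : exists xi eta, [/\ boundary T xi, boundary T eta &
  forall n, ~ Big (fixer (below [set xi n; eta n]))].
Proof.
pose P n := [set p : T * T | [/\ level p.1 = n, level p.2 = n &
                              ~ Big (fixer (below [set p.1; p.2]))]].
have [|||f Hf] := @koenig _ (fun p : T * T => (parent p.1, parent p.2)) P.
- move=> n; apply: (sub_finite_set _ (finite_setX (level_finite n lf) (level_finite n lf))).
  by move=> p [].
- by move=> n; have [v [w [lv lw nB]]] := small_pair n; exists (v, w).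
- move=> n [v w] [/= lv lw nB]; split; rewrite /= ?level_parent ?lv ?lw //.
  move=> B; apply: nB; apply: bigS B; apply: fixerS => u /belowP Pu; apply/belowP.
  by case: Pu => Pu; [left|right]; apply: subtree_trans (parent_subtree _) Pu.
exists (fun n => (f n).1), (fun n => (f n).2); split.
- apply/boundaryP => n; have [[l1 l2 _] e] := Hf n; split => //.
  by rewrite -[in RHS]e.
- apply/boundaryP => n; have [[l1 l2 _] e] := Hf n; split => //.
  by rewrite -[in RHS]e.
- by move=> n; have [[]] := Hf n.
Qed.

(** A nontrivial element of the rigid stabilizer of [xi m], taken in the core of [M], is corrected
    into [H] by an element fixing the subtree at [xi m], so its action there is unchanged. *)
Lemma big_moves xi m : boundary T xi -> Big (fixer (below [set xi m])) ->
  exists h k, [/\ H h, h (xi m) = xi m & h (xi k) <> xi k].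
Proof.
move=> bx /big_elim[M [sM MG fM HM]].
have sN := core_subgroup sG sM; have fN := fi_core sG sM fM.
have [a [Na am a1]] := fi_rist_nontrivial (xi m) sN fN.
have [w aw] := aut_moves a1.
have mw : subtree (xi m) w by apply: contrapT => n; apply: aw; have [_ ->] := am.
(* Conjugating by [x] brings the moved vertex [w] onto the ray. *)
have [x Gx xw] : exists2 x, G x & x (xi (level w)) = w.
  by apply: transG; rewrite ray_level.
have lw := subtree_level mw; rewrite ray_level // in lw.
have xm : x (xi m) = xi m.
  apply: (@subtree_inj _ _ _ w) => //; last by rewrite aut_level.
  by rewrite -xw aut_subtree; apply: ray_subtree.
have := core_sub sG (core_conj sG Na Gx) => /HM[l [_ fl] Hl].
have bm : rist G (xi m) (x^-1 * a * x).
  have xm' : x^-1 (xi m) = xi m by rewrite -{1}xm autK.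
  rewrite -[X in _ * X]invgK -[xi m]xm'; apply: rist_conj => //; exact: subgroupV.
exists (l^-1 * (x^-1 * a * x)), (level w).
have le u : subtree (xi m) u -> (l^-1 * (x^-1 * a * x)) u = (x^-1 * a * x) u.
  move=> mu; rewrite [LHS]autM; apply: (@aut_inj l); rewrite autVK fl //.
  by apply/below1P; apply: rist_subtree bm mu.
split => //; first by rewrite le ?(rist_fix bm) //; apply: subtree_refl.
rewrite le; last by apply: ray_subtree.
by rewrite !autM xw => /(congr1 (aut_fun x)); rewrite autVK xw.
Qed.

(** If neither ray is small, [H] contains [h] fixing [xi m] and moving [xi], and [h'] doing the same
    for [eta]. Each must map the pair at level [k] to one meeting it, which forces [h] to fix
    [eta k] and [h'] to fix [xi k]; then [h * h'] violates this. *)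
Lemma small_ray : exists2 xi, boundary T xi & forall n, ~ Big (fixer (below [set xi n])).
Proof.
have [xi [eta [bx be nB]]] := small_rays; apply: contrapT => no.
have bigray z : boundary T z -> exists n, Big (fixer (below [set z n])).
  move=> bz; apply: contrapT => nn; apply: no; exists z => // n B; apply: nn.
  by exists n.
have bigray_up z n k : boundary T z -> (n <= k)%N -> Big (fixer (below [set z n])) ->
    Big (fixer (below [set z k])).
  move=> bz nk; apply: bigS; apply: fixerS => u /below1P zu; apply/below1P.
  exact: subtree_trans (ray_subtree bz nk) zu.
have [n1 B1] := bigray _ bx; have [n2 B2] := bigray _ be.
have [n3 xe] : exists n, xi n <> eta n.
  apply: contrapT => nn; apply: (nB n1); apply: bigS B1; apply: fixerS => u.
  move=> /belowP Pu; apply/below1P; case: Pu => // eu; suff -> : xi n1 = eta n1 by [].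
  by apply: contrapT => xe; apply: nn; exists n1.
(* Level [m] is past the separation of the rays and the levels where each becomes big; [k] is also
   past the levels where [h] and [h'] move their rays. *)
pose m := maxn n1 (maxn n2 n3).
have [m1 m2 m3] : [/\ (n1 <= m)%N, (n2 <= m)%N & (n3 <= m)%N].
  by rewrite /m !leq_max !leqnn !orbT.
have sep u : subtree (xi m) u -> subtree (eta m) u -> False.
  move=> xu eu; apply: xe.
  apply: (@subtree_inj _ _ _ u); last by rewrite !ray_level.
    exact: subtree_trans (ray_subtree bx m3) xu.
  exact: subtree_trans (ray_subtree be m3) eu.
have [h [k1 [Hh hm hk]]] := big_moves bx (bigray_up _ _ _ bx m1 B1).
have [h' [k2 [Hh' hm' hk']]] := big_moves be (bigray_up _ _ _ be m2 B2).
pose k := maxn m (maxn k1 k2).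
have [mk k1k k2k] : [/\ (m <= k)%N, (k1 <= k)%N & (k2 <= k)%N].
  split; [exact: leq_maxl|exact: leq_trans (leq_maxl _ _) (leq_maxr _ _)|].
  exact: leq_trans (leq_maxr _ _) (leq_maxr _ _).
have hx := ray_moved bx k1k hk; have he := ray_moved be k2k hk'.
have xk : subtree (xi m) (xi k) by apply: ray_subtree.
have ek : subtree (eta m) (eta k) by apply: ray_subtree.
have [hxk hxk'] := subtree_stable hm xk.
have [hek hek'] := subtree_stable hm' ek.
have lev : [set xi k; eta k] `<=` [set v | level v = k].
  by move=> v [->|->]; rewrite /= ray_level.
have meet g : H g -> [\/ g (xi k) = xi k, g (xi k) = eta k, g (eta k) = xi k |
                       g (eta k) = eta k].
  move=> Hg; have [|v [vk [w [->|->] gw]]] := small_meet lev _ (nB k) (small_conj Hg (nB k)).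
    by move=> v [w /lev lw <-]; rewrite /= aut_level.
    by case: vk gw => -> ?; [constructor 1|constructor 2].
  by case: vk gw => -> ?; [constructor 3|constructor 4].
have h_e : h (eta k) = eta k.
  case: (meet h Hh) => // e; exfalso.
  - by apply: sep hxk _; rewrite e.
  - by apply: sep hxk' _; rewrite -e autK.
have h'_x : h' (xi k) = xi k.
  case: (meet h' Hh') => // e; exfalso.
  - by apply: sep _ hek'; rewrite -e autK.
  - by apply: sep _ hek; rewrite e.
have Hhh : H (h * h') by grp.
have := meet _ Hhh; rewrite !autM h'_x => -[//|e|e|e].
- by apply: sep hxk _; rewrite e.
- by apply: sep hxk' _; rewrite -e autK.
- by apply: he; apply: (@aut_inj h); rewrite e h_e.
Qed.

End TwoEnded.

End Subgroup.

(** * Rays and germ stabilizers *)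

Lemma ray_through w : exists2 eta, boundary T eta & eta (level w) = w.
Proof.
have child v : exists c : T, parent c = v /\ level c = (level v).+1.
  have [c lc] := level_nonempty (level v).+1.
  have [g Gg gc] : exists2 g, G g & g (parent c) = v.
    by apply: transG; rewrite level_parent lc.
  have lgc : level (g c) = (level v).+1 by rewrite aut_level.
  exists (g c); split => //; have sub : subtree v (g c).
    by rewrite -gc aut_subtree; apply: parent_subtree.
  by case/subtreeP: sub => _; rewrite lgc subSnn.
have [ch Hch] := choice child.
exists (fun n => if (n <= level w)%N then iter (level w - n) (@parent T) w
                 else iter (n - level w) ch w); last by rewrite leqnn subnn.
have lch k : level (iter k ch w) = (level w + k)%N.
  by elim: k => [|k IH]; rewrite ?addn0 //= (Hch _).2 IH addnS.
apply/boundaryP => n; case: (ltngtP n (level w)) => [nw|wn|->].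
- rewrite level_iter_parent subKn; last exact: ltnW.
  by split => //; rewrite -[LHS]/(iter (level w - n.+1).+1 _ w) subnSK.
- rewrite lch subnKC; last exact: ltnW.
  by rewrite subSn; [split => //=; rewrite (Hch _).1|exact: ltnW].
- by rewrite subnn subSnn /= (Hch _).1.
Qed.

(** A ray passes through every vertex, so fixing all rays of a cylinder amounts to fixing every
    vertex of the subtree. *)
Lemma germP xi g : boundary T xi ->
  germ_stabiliser G xi g <-> exists n, fixer (below [set xi n]) g.
Proof.
move=> bx; have ray_fixed eta n : boundary T eta -> eta n = xi n ->
    (forall w, below [set xi n] w -> g w = w) -> g \o eta = eta.
  move=> be en gn; apply/funext => k /=; have [nk|kn] := leqP n k.
    by apply: gn; apply/below1P; rewrite -en; apply: ray_subtree.
  apply: contrapT => /(ray_moved be (ltnW kn)); apply; rewrite en.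
  by apply: gn; apply/below1P; apply: subtree_refl.
split => [[[Gg gx] [U [[Ub [n nU]] HU]]]|[n [Gg gn]]].
  exists n; split => // w /below1P nw; have [eta be ew] := ray_through w.
  have lw := subtree_level nw; rewrite ray_level // in lw.
  have en : eta n = xi n.
    apply: (@subtree_inj _ _ _ w) => //; last by rewrite !ray_level.
    by rewrite -ew; apply: ray_subtree.
  by have /HU/(congr1 (fun f => f (level w))) /= := nU eta (conj be en); rewrite ew.
split; first by split => //; apply: ray_fixed gn.
exists (cylinder xi n); split; first by split => [eta []//|]; exists n.
by move=> eta [be en]; apply: ray_fixed gn.
Qed.

Lemma stabiliser_subgroup xi : is_subgroup (stabiliser G xi).
Proof.
split => [|g h [Gg gx] [Gh hx]|g [Gg gx]]; split; try by grp.
- by apply/funext => n /=; rewrite -[in RHS]gx -[in RHS]hx.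
- by apply/funext => n /=; rewrite -[in LHS]gx /= autK.
Qed.

Lemma germ_stabiliser_subgroup xi : boundary T xi -> is_subgroup (germ_stabiliser G xi).
Proof.
move=> bx; have up m n g : (m <= n)%N -> fixer (below [set xi m]) g ->
    fixer (below [set xi n]) g.
  move=> mn; apply: fixerS => w /below1P nw; apply/below1P.
  exact: subtree_trans (ray_subtree bx mn) nw.
split => [|g h|g].
- apply/(germP _ bx); exists 0%N; exact: subgroup1 (fixer_subgroup _).
- move=> /(germP _ bx)[m gm] /(germP _ bx)[n hn]; apply/(germP _ bx).
  exists (maxn m n); apply: subgroupM; first exact: fixer_subgroup.
    by apply: up gm; apply: leq_maxl.
  by apply: up hn; apply: leq_maxr.
- move=> /(germP _ bx)[m gm]; apply/(germP _ bx); exists m.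
  by have := subgroupV (fixer_subgroup _) gm.
Qed.

(** If the orbit were finite, an element of [G] would be determined by its action on it, since by
    transitivity its rays cover all vertices; [G] would be finite. *)
Lemma ray_orbit_infinite xi (Z : set (nat -> T)) : boundary T xi -> finite_set Z ->
  exists2 g, G g & ~ Z (g \o xi).
Proof.
move=> bx finZ; apply: contrapT => no; apply: infG.
have GZ g : G g -> Z (g \o xi).
  by move=> Gg; apply: contrapT => nZ; apply: no; exists g.
have [I [c cI]] := finite_colorV finZ.
have [t [Gt tP]] := fi_rep (fun g => c (g \o xi)) (subgroup1 sG).
apply: (@finite_color _ _ {ffun I -> I} (fun g => [ffun i => c ((g * t i) \o xi)])).
move=> g h Gg Gh /ffunP e; apply: tree_aut_ext => w.
have [x Gx xw] : exists2 x, G x & x (xi (level w)) = w.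
  by apply: transG; rewrite ray_level.
have tx : t (c (x \o xi)) \o xi = x \o xi.
  by apply: cI; [exact: GZ|exact: GZ|exact: tP].
have := e (c (x \o xi)); rewrite !ffunE => {}e.
have Gtx := Gt (c (x \o xi)).
have {}e : (g * t (c (x \o xi))) \o xi = (h * t (c (x \o xi))) \o xi.
  by apply: cI => //; apply: GZ; grp.
have /= tw := congr1 (fun f => f (level w)) tx.
have /= := congr1 (fun f => f (level w)) e.
by rewrite tw xw.
Qed.

(** * Subgroups of the stabilizer of a ray *)

Section RayStabiliser.
Variables (H : set (tree_aut T)) (xi : nat -> T).
Hypotheses (sH : is_subgroup H) (bx : boundary T xi) (Hx : H `<=` stabiliser G xi).
Hypothesis germs_fin : finite_set (germs G xi).
Hypothesis bigL : forall n,
  big G (@lcoset (tree_aut T)) H (fixer (~` below [set xi n])).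
Notation K n := (fixer (below [set xi n])).
Notation lc := (@lcoset (tree_aut T)).

Let HG : H `<=` G. Proof. by move=> h /Hx[]. Qed.

Lemma germ_normal n h k : G h -> lcoset h H = H -> K n k -> K n (h^-1 * k * h).
Proof.
move=> Gh /(stabP _ sH)/Hx[_ hx] Kk; have Gh' := subgroupV sG Gh.
have hn : h (xi n) = xi n by rewrite -[in RHS]hx.
rewrite -[X in _ * X]invgK; apply: fixer_conj Kk => // w.
move=> /below1P nw; apply/below1P; rewrite invgK -hn aut_subtree; exact: nw.
Qed.

Lemma germ_pure n A : almost_invariant G lc A ->
  exists2 V, finite_set V & forall g, G g ->
    (forall k, K n k -> ~ V (lc g (lc k H))) ->
    forall k, K n k -> (A (lc g (lc k H)) <-> A (lc g H)).
Proof.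
move=> cA; have lev : [set xi n] `<=` [set v | level v = n].
  by move=> _ ->; rewrite /= ray_level.
have [_ fgK] := fg_fixer_below lev.
apply: (pure_fibres sG (lcoset_action G) (fixer_subgroup _) (@fixerG _)
  (@germ_normal n) (L := fixer (~` below [set xi n])) fgK) => //.
- by move=> k l Kk Ll; apply/esym/(fixer_below_commute Ll Kk).
- exact: fixerG.
- by apply: (big_cover sG (lcoset_action G)); [exact: fixerG|exact: bigL].
Qed.

(** [K n] and [H] fix [xi], so all points of a fibre determine the same ray [g \o xi]. [V] accounts
    for finitely many rays and the orbit of [xi] is infinite. *)
Lemma germ_avoid n V : finite_set V ->
  exists2 g, G g & forall k, K n k -> ~ V (lc g (lc k H)).
Proof.
move=> finV; have rep (v : set (tree_aut T)) : exists g, lcosets G H v -> G g /\ lc g H = v.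
  have [[g Gg gv]|no] := pselect (lcosets G H v); first by exists g.
  by exists 1.
have [r Hr] := choice rep.
have [g Gg gZ] := ray_orbit_infinite bx (finite_image (fun C => r C \o xi) finV).
exists g => // k [Gk kx] Vk; apply: gZ; exists (lc g (lc k H)) => //.
rewrite -lcosetM; have [|Gr] := Hr (lc (g * k) H); first by exists (g * k) => //; grp.
move=> /(lcoset_eq _ _ sH)/Hx[_ hx].
have kx' : k \o xi = xi.
  by have [] : germ_stabiliser G xi k; [apply/(germP _ bx); exists n|case].
apply/funext => j /=; rewrite -[in LHS]hx /= autVK.
by rewrite -[in RHS]kx'.
Qed.

Section Bound.
Variable A : set (set (tree_aut T)).
Hypothesis cA : almost_invariant G lc A.
Hypothesis iA : infinite_set [set x | (exists2 g, G g & x = lcoset g H) /\ A x].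
Hypothesis inA : infinite_set [set x | (exists2 g, G g & x = lcoset g H) /\ ~ A x].

(** The germ stabilizer is the increasing union of the [K n], so a finite family comes from a single
    [n]; the bound from [fibre_bound] is the size of the boundary of [A]. *)
Lemma germ_orbit_bound : exists N, forall zs : seq (set (tree_aut T)), uniq zs ->
  (forall z, z \in zs -> exists2 k, germ_stabiliser G xi k & z = lc k H) ->
  (size zs <= N)%N.
Proof.
have SG := gens_sub GS.
have finW : finite_set [set x | exists2 s, S s & ~ A x /\ A (lc s x)].
  have finU : finite_set (\bigcup_(s in S) [set x | ~ A x /\ ~ ~ A (lc s x)]).
    apply: bigcup_finite => // s /SG Gs.
    exact: (almost_invariantC sG (lcoset_action G) cA Gs).
  apply: sub_finite_set finU => x [s Ss [nAx Asx]]; by exists s => //; split.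
have /finite_seqP[ws wsE] := finW; exists (size ws) => zs uz Hz.
have [n Hn] : exists n, forall z, z \in zs -> exists2 k, K n k & z = lc k H.
  elim: zs Hz {uz} => [|z zs IH] Hz; first by exists 0%N.
  have [|n Hn] := IH; first by move=> z' z'zs; apply: Hz; rewrite inE z'zs orbT.
  have [k /(germP _ bx)[m mk] zE] := Hz z (mem_head _ _).
  have up a b g : (a <= b)%N -> K a g -> K b g.
    move=> ab; apply: fixerS => w /below1P nw; apply/below1P.
    exact: subtree_trans (ray_subtree bx ab) nw.
  exists (maxn m n) => z'; rewrite inE => /orP[/eqP->|/Hn[k' k'n ->]].
    by exists k => //; apply: up mk; apply: leq_maxl.
  by exists k' => //; apply: up k'n; apply: leq_maxr.
have [V finV HV] := germ_pure n cA.
have cA' := almost_invariantC sG (lcoset_action G) cA.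
have [g Gg Ag] := pure_fibre_in sG (lcoset_action G) (fixer_subgroup _) (@fixerG _)
  (@germ_normal n) cA HV finV (germ_avoid n finV) iA.
have [|g' Gg' Ag'] := pure_fibre_in sG (lcoset_action G) (fixer_subgroup _) (@fixerG _)
  (@germ_normal n) cA' _ finV (germ_avoid n finV) inA.
  by move=> g' Gg' Vg' k Kk; split => /= nA A'; apply: nA;
    [rewrite HV //|rewrite -(HV g' Gg' Vg' k)].
apply: (fibre_bound sG (lcoset_action G) SV GS (fixer_subgroup _) (@fixerG _)
  (@germ_normal n) Gg Gg' Ag Ag' (ws0 := ws) _ uz Hn).
by rewrite wsE.
Qed.

Lemma ray_finite_index : finite_index (stabiliser G xi) H.
Proof.
split => //; apply/fi_lcosets => //.
have s0 := germ_stabiliser_subgroup bx.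
apply: (fi_trans (stabiliser_subgroup xi) (B := germ_stabiliser G xi)).
  exact/fi_lcosets.
apply/fi_lcosets => //; apply: contrapT => inf.
have [N HN] := germ_orbit_bound.
have [s [us ss sD]] := infinite_uniq N.+1 inf.
suff : (size s <= N)%N by rewrite ss ltnn.
by apply: HN us _ => z /sD[k Gk <-]; exists k.
Qed.

End Bound.

Section EndsBound.
Hypothesis fiH : finite_index (stabiliser G xi) H.

Lemma germ_orbit_level : exists n, forall k, germ_stabiliser G xi k ->
  exists2 k', K n k' & lc k H = lc k' H.
Proof.
have finD : finite_set (lcosets (germ_stabiliser G xi) H).
  by apply: sub_finite_set fiH.2 => _ [k [Gk _] <-]; exists k.
have lev C : exists n, lcosets (germ_stabiliser G xi) H C -> exists2 k, K n k & C = lc k H.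
  have [[k /(germP _ bx)[n kn] kC]|no] := pselect (lcosets (germ_stabiliser G xi) H C).
    by exists n => _; exists k.
  by exists 0%N.
have [f Hf] := choice lev; have /finite_seqP[s sE] := finite_image f finD.
exists (\max_(i <- s) i) => k Gk.
have DC : lcosets (germ_stabiliser G xi) H (lc k H) by exists k.
have [k' Kk' e] := Hf _ DC; exists k' => //.
apply: fixerS Kk' => w /below1P nw; apply/below1P; apply: subtree_trans _ nw.
apply: ray_subtree => //; apply: (@leq_bigmax_seq _ s xpredT id) => //.
have : [set` s] (f (lc k H)) by rewrite -sE; exists (lc k H).
by [].
Qed.

(** [A i] is replaced by the set [B i] of cosets of the germ stabilizer all of whose elements [c]
    have [lc c H] in [A i]. *)
Lemma germ_end_counts n : end_counts (schreier G S H) n -> (1 < n)%N ->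
  end_counts (graph_of_germs G S xi) n.
Proof.
move=> /(end_counts_disjoint sG SV GS)[A [HA dA]] n1.
have s0 := germ_stabiliser_subgroup bx.
set G0 := germ_stabiliser G xi in s0 *.
have G0G : G0 `<=` G by move=> g [[]].
have [m Hm] := germ_orbit_level.
have KG0 k : K m k -> G0 k by move=> Kk; apply/(germP _ bx); exists m.
have finD : finite_set (lcosets G0 H).
  by apply: sub_finite_set fiH.2 => _ [k [Gk _] <-]; exists k.
pose B i := [set C | lcosets G G0 C /\ forall c, C c -> A i (lc c H)].
apply: (disjoint_end_counts sG finS SV GS (A := B)); last first.
  move=> i j ni nj [_ [[[g Gg <-] Ai] [_ Aj]]]; apply: dA => //.
  by exists (lc g H); split; [apply: Ai|apply: Aj]; apply/lcosetP; gsimp; grp.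
move=> i ni; have [AX infA cA] := HA i ni; split; first by move=> C [].
  (* If [B i] were finite, so would be [A i]: its points lie in the finitely many fibres meeting
     [V], or over a coset in [B i], and each fibre is finite. *)
  move=> finB; apply: infA.
  have [V finV HV] := germ_pure m cA.
  pose r (y x : set (tree_aut T)) := exists g k, [/\ G g, K m k, x = lc g H & y = lc g (lc k H)].
  have fin1 : finite_set [set x | exists2 y, V y & r y x].
    apply: (finite_rel (r := r) finV) => // y Vy.
    have [[x [g [k [Gg Kk _ vE]]]]|no] := pselect (exists x, r y x); last first.
      by apply: (sub_finite_set _ (finite_set0 _)) => x rx; apply: no; exists x.
    apply: (finite_inv (r := lc g) finD) => x' [g' [k' [Gg' Kk' x'E vE']]].
    have : fibre lc H (K m) g x'.
      rewrite (fibre_eq sG (lcoset_action G) (fixer_subgroup _) (@fixerG _)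
        (@germ_normal m) Gg Gg').
        by exists 1; [exact: subgroup1 (fixer_subgroup _)|rewrite lcoset1].
      by exists y; split; [exists k|exists k'].
    by move=> [k2 Kk2 <-]; exists (lc k2 H) => //; exists k2 => //; apply: KG0.
  have fin2 : finite_set (\bigcup_(C in B i) [set lc c H | c in C]).
    apply: bigcup_finite => // _ [[g Gg <-] _].
    apply: (finite_inv (r := lc g) finD) => _ [_ [k Gk <-] <-].
    by exists (lc k H); [exists k|rewrite lcosetM].
  have finU : finite_set ([set x | exists2 y, V y & r y x] `|`
      \bigcup_(C in B i) [set lc c H | c in C]) by rewrite finite_setU.
  apply: sub_finite_set finU => x Ax; have [g Gg xE] := AX _ Ax.
  have [[k Kk Vk]|noV] := pselect (exists2 k, K m k & V (lc g (lc k H))).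
    by left; exists (lc g (lc k H)) => //; exists g, k.
  right; exists (lc g G0); last by exists g => //; apply/lcosetP; gsimp; grp.
  split => [|_ [k0 Gk0 <-]]; first by exists g.
  have [k' Kk' e] := Hm _ Gk0; rewrite lcosetM e HV ?xE // => k Kk Vk.
  by apply: noV; exists k.
(* A coset leaving [B i] contains some [c1] for which [lc c1 H] leaves [A i]. Finitely many
   [lc c1 H] occur, and each comes from finitely many germ cosets because the group of germs is
   finite. *)
move=> g Gg; apply: (finite_rel (r := fun x C => exists2 c, C = lc c G0 /\ G c & x = lc c H)
    (cA g Gg)) => [x _|C [[[c Gc <-] AC] nB]].
  have [[C [c [CE Gc] xE]]|no] := pselect (exists C, exists2 c, C = lc c G0 /\ G c & x = lc c H);
    last by apply: (sub_finite_set _ (finite_set0 _)) => C rC; apply: no; exists C.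
  apply: (finite_inv (r := lc c) germs_fin) => _ [c' [-> Gc'] xE'].
  have Hcc : H (c^-1 * c') by apply/(lcoset_eq _ _ sH); rewrite -xE -xE'.
  exists (lc (c^-1 * c') G0); first by exists (c^-1 * c') => //; apply: Hx.
  by rewrite -lcosetM; gsimp.
have [c' cc' nA] : exists2 c', lc g (lc c G0) c' & ~ A i (lc c' H).
  apply: contrapT => no; apply: nB; split.
    by rewrite -lcosetM; exists (g * c) => //; grp.
  by move=> c' cc'; apply: contrapT => nA; apply: no; exists c'.
move: cc' => [c1 cc1 e]; have [k Gk c1E] := cc1.
exists (lc c1 H); last first.
  exists c1 => //; split; last by rewrite -c1E; have := G0G _ Gk; grp => ?; grp.
  by apply/(lcoset_eq _ _ s0); rewrite -c1E; gsimp.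
by split; [apply: AC|rewrite -lcosetM e].
Qed.

End EndsBound.

End RayStabiliser.

(** * Subgroups with several ends and the criterion for Property FW *)

Hypothesis germs_fin : forall xi, boundary T xi -> finite_set (germs G xi).
Notation lc := (@lcoset (tree_aut T)).

Lemma normal_virtually_abelian N a : normal_in N -> N a -> a <> 1 -> exists R,
  [/\ is_subgroup R, R `<=` G, fin_index G R &
      forall a b, R a -> R b -> N (a * b * a^-1 * b^-1)].
Proof.
move=> nN Na a1; have [n Hn] := normal_commutators nN Na a1.
exists (rist_level G n); split => //; first exact: generated_subgroup.
  by have [] := ristG n.
exact: fi_rist_level.
Qed.

Lemma core_normal H : is_subgroup H -> normal_in (core G H).
Proof.
move=> sH; split; first exact: core_subgroup.
  by move=> g [].
move=> x n Gx Hn; have := core_conj sG Hn (subgroupV sG Gx); by rewrite invgK.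
Qed.

Lemma not_faithful_core H : is_subgroup H -> ~ faithful_on_cosets G H ->
  exists2 a, core G H a & a <> 1.
Proof.
move=> sH nf; apply: contrapT => no; apply: nf => g Gg gC.
apply: contrapT => g1; apply: no; exists g => //; split => // x Gx.
have GxH : lcosets G H (lc x H) by exists x.
have := gC _ GxH; rewrite -lcosetM => /esym/(lcoset_eq _ _ sH); by gsimp.
Qed.

Lemma faithful_core H : is_subgroup H -> faithful_on_cosets G H ->
  forall a, G a -> (forall x, G x -> H (x^-1 * a * x)) -> a = 1.
Proof.
move=> sH fH a Ga Ha; apply: fH => // _ [x Gx <-]; rewrite -lcosetM.
by apply/esym/(lcoset_eq _ _ sH); rewrite mulgA; apply: Ha.
Qed.

(** The core of [H] is then a nontrivial normal subgroup, so it contains the commutators of some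
    [rist_level G n], which has finite index. *)
Lemma not_faithful_factors H : is_subgroup H -> ~ faithful_on_cosets G H ->
  factors_through_virtually_abelian G H.
Proof.
move=> sH /(not_faithful_core sH)[a ca a1].
have [R [sR RG fR RN]] := normal_virtually_abelian (core_normal sH) ca a1.
apply: (virtually_abelian_action sG sR RG fR) => // b c Rb Rc x Gx.
by have [_] := RN _ _ Rb Rc; apply.
Qed.

Lemma several_ends H : is_subgroup H -> H `<=` G ->
  ~~ enat_le (num_ends (schreier G S H)) (Some 1%N) ->
  (~ faithful_on_cosets G H /\ factors_through_virtually_abelian G H) \/
  (exists xi, [/\ boundary T xi, finite_index (stabiliser G xi) H &
     enat_le (num_ends (schreier G S H)) (num_ends (graph_of_germs G S xi))]).
Proof.
move=> sH HG /num_ends_gt1[n0 n1 En0].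
have [fH|nf] := pselect (faithful_on_cosets G H); last first.
  by left; split => //; apply: not_faithful_factors.
right; have fH' := faithful_core sH fH.
have [A [HA dA]] := end_counts_disjoint sG SV GS En0.
have [A0X inf0 cA] := HA 0%N (ltnW n1); have [A1X inf1 _] := HA 1%N n1.
have iA : infinite_set [set x | (exists2 g, G g & x = lc g H) /\ A 0%N x].
  by apply: sub_infinite_set inf0 => x Ax; split => //; have [g Gg <-] := A0X _ Ax; exists g.
have inA : infinite_set [set x | (exists2 g, G g & x = lc g H) /\ ~ A 0%N x].
  apply: sub_infinite_set inf1 => x Ax; split.
    by have [g Gg <-] := A1X _ Ax; exists g.
  move=> Ax0; suff : 0%N = 1%N by [].
  by apply: dA => //; [exact: ltnW|exists x].
have [xi bx nB] := small_ray sH HG fH' cA iA inA.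
have lev n : [set xi n] `<=` [set v | level v = n] by move=> _ ->; rewrite /= ray_level.
have Hx : H `<=` stabiliser G xi.
  move=> h Hh; split; first exact: HG.
  apply/funext => n /=.
  (* The single vertex [xi n] and its image under [h] are both small, so they meet, that is, they
     coincide. *)
  have [|v [vx [w wx hw]]] := small_meet cA iA inA (lev n) _ (nB n)
    (small_conj sH HG Hh (nB n)).
    by move=> _ [v /lev lv <-]; rewrite /= aut_level.
  by rewrite -[RHS]vx -hw wx.
have bigL n : big G lc H (fixer (~` below [set xi n])).
  by have [//|/nB] := big_below cA iA inA (lev n).
have fiH := ray_finite_index sH bx Hx (germs_fin bx) bigL cA iA inA.
exists xi; split => //; apply: num_ends_le => n En.
have germ_ends := germ_end_counts sH bx Hx (germs_fin bx) bigL fiH.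
have [nn1|] := ltnP 1 n; first exact: germ_ends En nn1.
(* Counts up to 1 follow by monotonicity from the count [n0], which exceeds 1. *)
move=> nle; apply: (end_counts_le (n := n0)); last exact: germ_ends En0 n1.
exact: leq_trans nle (ltnW n1).
Qed.

Lemma normal_in_is_normal N : is_normal N G -> normal_in N.
Proof.
move=> [sN NG nN]; split => // x n Gx Nn.
by have := nN x^-1 n (subgroupV sG Gx) Nn; rewrite conjgE; gsimp.
Qed.

Lemma germ_infinite_index xi : boundary T xi ->
  infinite_set (lcosets G (germ_stabiliser G xi)).
Proof.
move=> bx /(fi_lcosets _ (germ_stabiliser_subgroup bx))[I [f fI]].
have [t [Gt ft]] := fi_rep f (subgroup1 sG).
have finZ : finite_set ((fun i => t i \o xi) @` [set: I]).
  by apply: finite_image; exact: finite_finset.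
have [g Gg] := ray_orbit_infinite bx finZ; apply; exists (f g) => //.
have [[_ e] _] := fI _ _ (Gt (f g)) Gg (ft _ Gg).
by apply/funext => n /=; rewrite -[in LHS]e /= autVK.
Qed.

Lemma FW_just_infinite : property_FW G -> just_infinite G.
Proof.
move=> FW N nN N1; have nN' := normal_in_is_normal nN; have [sN NG nNc] := nN'.
have [a Na a1] : exists2 a, N a & a <> 1.
  apply: contrapT => no; apply: N1; apply/seteqP; split => [a Na|_ ->].
    by apply: contrapT => a1; apply: no; exists a.
  exact: subgroup1.
have [R [sR RG fR RN]] := normal_virtually_abelian nN' Na a1.
apply/fi_lcosets => //; apply: (FW_virtually_abelian sG FW sN NG nNc sR RG fR _ RN).
exact: fg_fi sG sR RG fg_G fR.
Qed.

Lemma FW_one_ended xi : property_FW G -> boundary T xi ->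
  one_ended (graph_of_germs G S xi).
Proof.
move=> FW bx; have s0 := germ_stabiliser_subgroup bx; have inf := germ_infinite_index bx.
apply: one_endedP.
  apply: (disjoint_end_counts sG finS SV GS (A := fun=> lcosets G (germ_stabiliser G xi))).
    move=> i _; split => // g Gg; apply: sub_finite_set (finite_set0 _) => x [Xx nX].
    by apply: nX; apply: lcosets_act.
  by move=> [|i] [|j].
move=> n /(end_counts_disjoint sG SV GS)[A [HA dA]]; rewrite leqNgt; apply/negP => n1.
have [A0X inf0 cA] := HA 0%N (ltnW n1); have [A1X inf1 _] := HA 1%N n1.
have [//|fin] := FW_transitive sG FW s0 A0X cA.
apply: inf1; apply: sub_finite_set fin => x Ax; split; first exact: A1X.
by move=> A0x; have : 0%N = 1%N by apply: dA => //; [exact: ltnW|exists x].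
Qed.

(** A commensurated set of cosets, infinite with infinite complement, gives two ends. One-endedness
    of the graphs of germs rules out the ray case; otherwise the core of [H] is nontrivial, and
    just-infiniteness makes [G/H] finite. *)
Lemma FW_of_one_ended : just_infinite G ->
  (forall xi, boundary T xi -> one_ended (graph_of_germs G S xi)) -> property_FW G.
Proof.
move=> JI oe; apply: (FW_of_cosets sG fg_G) => H A sH HG AX cA.
apply: contrapT => /not_orP[infA infC].
have gt1 : ~~ enat_le (num_ends (schreier G S H)) (Some 1%N).
  apply: (num_ends_gt1V (n := 2)) => //.
  apply: (disjoint_end_counts sG finS SV GS
    (A := fun i => if i == 0%N then A else lcosets G H `\` A)) => [i _|].
    case: ifP => _; first by split.
    split => //.
    have cA' := almost_invariantC sG (lcoset_action G) cA.
    move=> g Gg; apply: sub_finite_set (cA' g Gg) => x [[Xx nA] nXA]; split => //.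
    by move=> nAg; apply: nXA; split => //; apply: lcosets_act.
  by move=> [|[|i]] [|[|j]] //= _ _ [x []] => [Ax [_ /(_ Ax)]|[_ nA] /nA].
have [[nf _]|[xi [bx _]]] := several_ends sH HG gt1; last first.
  by have := oe _ bx; rewrite /one_ended => -> le1; rewrite le1 in gt1.
have [a ca a1] := not_faithful_core sH nf.
have [sN NG nN] := core_normal sH.
have fN : finite_set (lcosets G (core G H)).
  apply: JI; first split => //.
    move=> g n Gg Nn; have := nN _ _ (subgroupV sG Gg) Nn.
    by rewrite conjgE; gsimp.
  by move=> e; rewrite e in ca; apply: a1.
have fH : finite_set (lcosets G H).
  apply/fi_lcosets => //; apply: (@fiS _ G G (core G H)) => //.
    exact: core_sub.
  exact/fi_lcosets.
by apply: infA; apply: sub_finite_set fH.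
Qed.

End Branch.

Theorem theorem1 (T : rooted_tree) (G S : set (tree_aut T)) :
  locally_finite T ->
  spherically_homogeneous T ->
  is_subgroup G ->
  symmetric_generating_set S G ->
  is_branch G ->
  (forall xi, boundary T xi -> finite_set (germs G xi)) ->
  (forall H : set (tree_aut T),
     is_subgroup H -> H `<=` G ->
     ~~ enat_le (num_ends (schreier G S H)) (Some 1%N) ->
     (~ faithful_on_cosets G H /\ factors_through_virtually_abelian G H)
     \/
     (exists xi, [/\ boundary T xi,
                     finite_index (stabiliser G xi) H &
                     enat_le (num_ends (schreier G S H))
                             (num_ends (graph_of_germs G S xi))]))
  /\
  (infinite_set G ->
   (property_FW G <->
    just_infinite G /\
    (forall xi, boundary T xi -> one_ended (graph_of_germs G S xi)))).
Proof.
move=> lf _ sG [finS SV GS] [transG ristG] germs_fin; split => [H sH HG gt1|infG].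
  (* More than one end forces [G/H], hence [G], to be infinite. *)
  have infG : infinite_set G.
    have [n n1 En] := num_ends_gt1 gt1.
    have [A [HA _]] := end_counts_disjoint sG SV GS En.
    have [AX infA _] := HA 0%N (ltnW n1).
    by move=> finG; apply: infA; apply: sub_finite_set AX _; apply: finite_image.
  exact: several_ends.
split => [FW|[JI oe]].
  split => [|xi bx]; first exact: (FW_just_infinite sG finS GS transG ristG).
  exact: FW_one_ended.
exact: (@FW_of_one_ended T G S).
Qed.
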